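(* Let $Q,N\in\mathbb{N}$, $M\in\mathbb{Z}$, and let $a_{M+1},\dots,a_{M+N}$ be complex numbers. Then for every $\epsilon>0$, \[ \sum_{\substack{q\le Q\\ q\ \text{prime}}}\frac{q}{\varphi(q)}\sum_{\xi\in G_1(q)}\Bigl|\sum_{n=M+1}^{M+N}a_n\,\xi(n)\Bigr|^2\ll_{\epsilon} Q^{\epsilon}\left(NQ^{1/2}+N^{1/4}Q^{2}+N^{3/4}Q^{11/8}\right)\sum_{n=M+1}^{M+N}|a_n|^2, \] where the implied constant depends only on $\epsilon$.
   Context: $e(x)=\exp(2\pi i x)$ and $\varphi$ is Euler's function. For a positive integer $q$, $G_1(q)$ denotes the set of Dirichlet characters $\xi$ modulo $q^2$ such that $\xi(x)=e\!\left(\frac{x-1}{q^2}\right)$ for every integer $x\equiv 1\pmod q$ (there are exactly $\varphi(q)$ such characters). Dirichlet characters modulo $q^2$ vanish on integers not coprime to $q$. *)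

(* Defs.v *)
From HB Require Import structures.
From mathcomp Require Import all_boot all_order all_algebra.
From mathcomp Require Import all_classical all_reals all_analysis.
From mathcomp Require Import complex.
Set Implicit Arguments. Unset Strict Implicit. Unset Printing Implicit Defensive.
Import Order.TTheory GRing.Theory Num.Theory.
Local Open Scope ring_scope.
Local Open Scope complex_scope.

Definition e (R : realType) (x : R) : R[i] :=
  (cos (2 * pi * x)) +i* (sin (2 * pi * x)).

(* Dirichlet character modulo m, viewed as a function on the integers:
   periodic mod m, completely multiplicative, chi(1) = 1, and vanishing on
   integers not coprime to m (equivalently: a homomorphism (Z/mZ)^* -> C^*
   extended by 0). *)
Definition dirichlet_char (R : realType) (m : nat) (chi : int -> R[i]) : Prop :=
  [/\ forall n : int, chi (n + m%:Z)%R = chi n,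
      forall a b : int, chi (a * b)%R = chi a * chi b,
      chi 1%R = 1
    & forall n : int, ~~ coprime `|n|%N m -> chi n = 0].

Definition G1 (R : realType) (q : nat) : set (int -> R[i]) :=
  [set chi | dirichlet_char (q ^ 2) chi /\
     forall x : int, (x = 1 %[mod q%:Z])%Z ->
       chi x = e ((x - 1)%:~R / (q ^ 2)%:R)].

Definition cabs2 (R : realType) (z : R[i]) : R := (complex.Re z) ^+ 2 + (complex.Im z) ^+ 2.

(* Main.v *)
(* For a prime [q], the characters in [G_1(q)] agree on [1 mod q], and their
   orthogonality turns [q/phi(q) sum_xi |sum_n a_n xi(n)|^2] into
   [q sum_b |sum_(n = b mod q) a_n e(n' n / q^2)|^2], where [n'] is the inverse
   of [n] modulo [q].  By duality it is enough to bound
   [sum_n |sum_q q y_q(n) e(n' n / q^2)|^2] for [q]-periodic [y_q], and the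
   primes may be restricted to [Q/2 < q <= Q].  The sums over [n] attached to
   two distinct primes [q], [q'] are estimated as follows.

   Write [n = k q' + m] with [q | m] and [t = m/q].  Up to factors depending on
   [k] alone or on [m] alone, the phase is [e((k q')' t / q - m' k / q')].  With
   a Fejer weight on [n], both [k] and [t] run through windows of length about
   [N/Q].  After two applications of Cauchy-Schwarz there remains
   [sum_(k1, k2) |sum_t e(((k1 q')' - (k2 q')') t / q - m' (k1 - k2) / q')|^2].
   For fixed [k1 - k2 <> 0] the frequency [(k1 q')' - (k2 q')'] takes every
   value modulo [q] at most twice, so Parseval modulo [q] applies; no bound for
   Kloosterman sums is needed.  This gives [Q^(7/4) N^(1/2) + N Q^(3/4)].

   For large [N], Parseval on [F_q * F_q'] bounds the Hilbert-Schmidt norm of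
   the form and gives [N + Q^2 N^(1/2)]; for small [N] the trivial bound
   [N Q + Q^2] is enough.  The three bounds are used for [N <= Q^(3/2)],
   [Q^(3/2) <= N <= Q^(5/2)] (the form above) and [N >= Q^(5/2)]. *)
Require Import Defs.
From HB Require Import structures.
From mathcomp Require Import all_boot all_order all_algebra.
From mathcomp Require Import all_classical all_reals all_analysis.
From mathcomp Require Import complex.
From mathcomp Require Import zify ring lra.
From mathcomp Require Import cyclic finmap.
Set Implicit Arguments. Unset Strict Implicit. Unset Printing Implicit Defensive.
Import Order.TTheory GRing.Theory Num.Theory.
Local Open Scope ring_scope.
Local Open Scope complex_scope.

(** * Squared moduli, Cauchy-Schwarz and duality *)

Section Cabs2.
Context {R : realType}.
Implicit Types (x y z : R[i]) (u v : R).

Lemma cabs2_ge0 z : 0 <= cabs2 z.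
Proof. by rewrite /cabs2 addr_ge0 ?sqr_ge0. Qed.

Lemma cabs20 : cabs2 (0 : R[i]) = 0.
Proof. by rewrite /cabs2 /= expr0n addr0. Qed.

Lemma cabs2M x y : cabs2 (x * y) = cabs2 x * cabs2 y.
Proof. by case: x => a b; case: y => c d; rewrite /cabs2 /=; ring. Qed.

Lemma cabs2_conj z : cabs2 (conjc z) = cabs2 z.
Proof. by case: z => a b; rewrite /cabs2 /= sqrrN. Qed.

Lemma cabs2_real u : cabs2 u%:C = u ^+ 2.
Proof. by rewrite /cabs2 /= expr0n addr0. Qed.

Lemma conjcM x y : conjc (x * y) = conjc x * conjc y.
Proof. exact: rmorphM. Qed.

Lemma mul_conj z : z * conjc z = (cabs2 z)%:C.
Proof.
by case: z => a b; rewrite /cabs2 /=; simpc; congr (_ +i* _); ring.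
Qed.

Lemma cabs2D_le x y : cabs2 (x + y) <= 2 * (cabs2 x + cabs2 y).
Proof.
case: x => a b; case: y => c d; rewrite /cabs2 /=.
have := sqr_ge0 (a - c); have := sqr_ge0 (b - d); nra.
Qed.

Lemma Re_sum (I : Type) (s : seq I) (P : pred I) (F : I -> R[i]) :
  complex.Re (\sum_(i <- s | P i) F i) = \sum_(i <- s | P i) complex.Re (F i).
Proof. by apply: (big_morph (@complex.Re R)) => // -[a b] [c d]. Qed.

Lemma RtoC_sum (I : Type) (s : seq I) (P : pred I) (F : I -> R) :
  (\sum_(i <- s | P i) F i)%:C = \sum_(i <- s | P i) (F i)%:C.
Proof. exact: (raddf_sum (real_complex R)). Qed.

Lemma conj_sum (I : Type) (s : seq I) (P : pred I) (F : I -> R[i]) :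
  conjc (\sum_(i <- s | P i) F i) = \sum_(i <- s | P i) conjc (F i).
Proof. exact: (raddf_sum (@conjc R)). Qed.

Lemma Re_sqr_le z : (complex.Re z) ^+ 2 <= cabs2 z.
Proof. by rewrite /cabs2 lerDl sqr_ge0. Qed.

Lemma ler_AMGM u v t : 0 <= u -> 0 <= v -> t ^+ 2 <= u * v -> 2 * t <= u + v.
Proof.
move=> u0 v0 tuv; rewrite leNgt; apply/negP => h.
have := sqr_ge0 (u - v); nra.
Qed.

(** Induction on the list: |z S|^2 <= (x y)(A B), so AM-GM bounds the cross term 2 Re(z conj S) by x
    B + A y. *)
Lemma cabs2_sum_le (I : Type) (s : seq I) (P : pred I) (w : I -> R[i])
    (X Y : I -> R) :
  (forall i, P i -> 0 <= X i) -> (forall i, P i -> 0 <= Y i) ->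
  (forall i, P i -> cabs2 (w i) <= X i * Y i) ->
  cabs2 (\sum_(i <- s | P i) w i) <=
    (\sum_(i <- s | P i) X i) * (\sum_(i <- s | P i) Y i).
Proof.
move=> X0 Y0 wXY; elim: s => [|i s IH]; first by rewrite !big_nil cabs20 mul0r.
rewrite !big_cons; case: ifP => // Pi.
move: IH (X0 _ Pi) (Y0 _ Pi) (wXY _ Pi).
have := @sumr_ge0 _ _ s P _ X0; have := @sumr_ge0 _ _ s P _ Y0.
move: (\sum_(j <- s | P j) X j) (\sum_(j <- s | P j) Y j) (\sum_(j <- s | P j) w j).
move: (w i) (X i) (Y i) => z x y A B S B0 A0 SAB x0 y0 zxy.
have E : cabs2 (z + S) = cabs2 z + cabs2 S + 2 * complex.Re (z * conjc S).
  by case: (z) => a b; case: (S) => c d; rewrite /cabs2 /=; ring.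
rewrite E.
suff : 2 * complex.Re (z * conjc S) <= x * B + A * y by move: SAB zxy; nra.
apply: ler_AMGM; [by rewrite mulr_ge0 | by rewrite mulr_ge0 |].
apply: le_trans (Re_sqr_le _) _; rewrite cabs2M cabs2_conj.
apply: le_trans (ler_pM (cabs2_ge0 _) (cabs2_ge0 _) zxy SAB) _.
lra.
Qed.

Lemma cabs2_CS (I : Type) (s : seq I) (P : pred I) (f g : I -> R[i]) :
  cabs2 (\sum_(i <- s | P i) f i * g i) <=
    (\sum_(i <- s | P i) cabs2 (f i)) * (\sum_(i <- s | P i) cabs2 (g i)).
Proof.
apply: cabs2_sum_le => i _; [exact: cabs2_ge0 | exact: cabs2_ge0 |].
by rewrite cabs2M.
Qed.

Lemma cabs2_sum_card (I : finType) (P : pred I) (f : I -> R[i]) :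
  cabs2 (\sum_(i | P i) f i) <= #|P|%:R * \sum_(i | P i) cabs2 (f i).
Proof.
have := @cabs2_sum_le I (index_enum I) P f (fun=> 1) (fun i => cabs2 (f i)).
rewrite sumr_const; apply => // i _; first exact: cabs2_ge0.
by rewrite mul1r.
Qed.

(** Let c_t be the inner sum on the left and X that whole side. Then X = sum_i a_i (sum_t w_t
    conj(c_t) v_t(i)). Cauchy-Schwarz and the hypothesis at y = conj(c) give X^2 <= B |a|^2 X, and X
    cancels. *)
Lemma duality (T I : finType) (B : R) (w : T -> R) (v : T -> I -> R[i]) :
  0 <= B -> (forall t, 0 <= w t) ->
  (forall y : T -> R[i],
     \sum_i cabs2 (\sum_t (w t)%:C * y t * v t i) <= B * \sum_t w t * cabs2 (y t)) ->
  forall a : I -> R[i],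
  \sum_t w t * cabs2 (\sum_i a i * v t i) <= B * \sum_i cabs2 (a i).
Proof.
move=> B0 w0 H a; set c := fun t => \sum_i a i * v t i.
set X := (X in X <= _).
have X0 : 0 <= X by apply: sumr_ge0 => t _; rewrite mulr_ge0 ?cabs2_ge0.
have XE : X%:C = \sum_i a i * \sum_t (w t)%:C * conjc (c t) * v t i.
  rewrite /X RtoC_sum; under [RHS]eq_bigr do rewrite mulr_sumr.
  rewrite exchange_big; apply: eq_bigr => t _ /=.
  rewrite -/(c t) rmorphM /= -mul_conj {1}/c mulrA mulr_sumr mulr_suml.
  by apply: eq_bigr => i _; ring.
have : X ^+ 2 <= (\sum_i cabs2 (a i)) * (B * X).
  rewrite -cabs2_real XE; apply: le_trans (cabs2_CS _ _ _ _) _.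
  apply: ler_wpM2l; first by apply: sumr_ge0 => i _; exact: cabs2_ge0.
  apply: le_trans (H _) _; rewrite /X.
  by under eq_bigr do rewrite cabs2_conj.
move=> XX; have [->|Xn0] := eqVneq X 0.
  by rewrite mulr_ge0 // sumr_ge0 // => i _; exact: cabs2_ge0.
have Xp : 0 < X by rewrite lt_neqAle eq_sym Xn0.
by rewrite -(ler_pM2r Xp); apply: le_trans XX _; lra.
Qed.

End Cabs2.

(** * Counting fibres and residue classes *)

Section Counting.

Lemma sum_fiber_le (R : realDomainType) (I T : finType) (P : pred I) (phi : I -> T)
    (m : nat) (F : T -> R) :
  (forall t, 0 <= F t) ->
  (forall t, (#|[pred i | P i && (phi i == t)]| <= m)%N) ->
  \sum_(i | P i) F (phi i) <= m%:R * \sum_t F t.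
Proof.
move=> F0 H; rewrite (partition_big phi xpredT) //= mulr_sumr.
apply: ler_sum => t _.
rewrite (eq_bigr (fun=> F t)); last by move=> i /andP[_ /eqP->].
by rewrite sumr_const -[leLHS]mulr_natl ler_wpM2r // ler_nat; apply: H.
Qed.

(** Members of one class modulo [r] are told apart by their quotient by [r], which takes at most
    [K %/ r + 1] values. *)
Lemma card_mod_le (r K : nat) (P : pred 'I_K) : (0 < r)%N ->
  (forall i j : 'I_K, P i -> P j -> i = j %[mod r]) -> (#|P| <= K %/ r + 1)%N.
Proof.
move=> r0 H.
rewrite -[leqRHS]card_ord.
have le (i : 'I_K) : (i %/ r < (K %/ r).+1)%N.
  by rewrite ltnS leq_div2r // ltnW.
pose g (i : 'I_K) : 'I_(K %/ r + 1) := cast_ord (esym (addn1 _)) (Ordinal (le i)).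
have gi : {in P &, injective g}.
  move=> i j iP jP /(congr1 (fun o => val o)) /= E; apply: val_inj.
  by rewrite /= (divn_eq i r) (divn_eq j r) E (H i j).
by rewrite -(card_in_image gi) max_card.
Qed.

End Counting.

(** * The exponential [e] at rational points *)

Section Exponential.
Context {R : realType}.
Implicit Types (x y : R).

Lemma eD x y : e (x + y) = e x * e y :> R[i].
Proof.
rewrite /e mulrDr cosD sinD; apply/eqP; rewrite eq_complex /=.
by apply/andP; split; apply/eqP; ring.
Qed.

Lemma conj_e x : conjc (e x) = e (- x) :> R[i].
Proof. by rewrite /e mulrN cosN sinN. Qed.

Lemma cabs2_e x : cabs2 (e x) = 1.
Proof. by rewrite /cabs2 /e /= cos2Dsin2. Qed.

Lemma e0 : e 0 = 1 :> R[i].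
Proof. by rewrite /e mulr0 cos0 sin0. Qed.

Lemma e1 : e 1 = 1 :> R[i].
Proof. by rewrite /e mulr1 mulr_natl cos2pi sin2pi. Qed.

Lemma e_nat (n : nat) : e (n%:R : R) = 1.
Proof. by elim: n => [|n IH]; rewrite ?e0 // -natr1 eD IH e1 mulr1. Qed.

Lemma e_int (n : int) : e (n%:~R : R) = 1.
Proof.
case: n => n; first exact: e_nat.
by rewrite NegzE mulrNz -conj_e e_nat conjc1.
Qed.

(** The angle t = pi d / q lies in (0, pi), where the sine is positive, so the real part cos(2t) = 1
    - 2 sin(t)^2 is below 1. *)
Lemma e_frac_neq1 (d q : nat) : (0 < d < q)%N -> e (d%:R / q%:R : R) != 1.
Proof.
move=> /andP[d0 dq]; apply/eqP => /(congr1 (@complex.Re R)); rewrite /e /=.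
set t := pi * (d%:R / q%:R) : R.
have -> : 2 * pi * (d%:R / q%:R) = t *+ 2 :> R.
  by rewrite /t [2 * pi]mulr_natl !mulr2n mulrDl.
have q0 : 0 < q%:R :> R by rewrite ltr0n (leq_trans _ dq).
have : 0 < sin t.
  apply: sin_gt0_pi; rewrite /t mulr_gt0 ?pi_gt0 ?divr_gt0 ?ltr0n ?(leq_trans _ dq) //=.
  by rewrite gtr_pMr ?pi_gt0 // ltr_pdivrMr ?mul1r ?ltr_nat ?ltr0n ?(leq_trans _ dq).
rewrite cos_mulr2n; have := cos2Dsin2 t; nra.
Qed.

Lemma e_eqmod (q : nat) (a b : int) : (0 < q)%N -> (a = b %[mod q%:Z])%Z ->
  e (a%:~R / q%:R : R) = e (b%:~R / q%:R).
Proof.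
move=> q0 /eqP; rewrite eqz_mod_dvd => /dvdzP[k E].
have -> : a = b + k * q%:Z by rewrite -E; ring.
rewrite rmorphD rmorphM /= mulrDl eD -mulrA divff ?mulr1 ?e_int ?mulr1 //.
by rewrite pnatr_eq0 -lt0n.
Qed.

Lemma e_eq1 (q : nat) (a : int) : (0 < q)%N ->
  (e (a%:~R / q%:R : R) == 1) = (q%:Z %| a)%Z.
Proof.
move=> q0; apply/idP/idP => [|/dvdzP[k ->]]; last first.
  by rewrite rmorphM /= -mulrA divff ?mulr1 ?e_int // pnatr_eq0 -lt0n.
apply: contraLR => nq.
rewrite (@e_eqmod _ _ (a %% q%:Z)%Z) ?modz_mod //.
have q0' : q%:Z != 0 by lia.
have Hm : (a %% q%:Z)%Z = 0 -> (q%:Z %| a)%Z by move/dvdz_mod0P.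
have q0'' : 0 < q%:Z by lia.
case: (a %% q%:Z)%Z (modz_ge0 a q0') (ltz_pmod a q0'') Hm => // d _ dq Hm.
apply: e_frac_neq1; rewrite lt0n; apply/andP; split; last exact: dq.
by apply: contraNneq nq => d0; apply: Hm; rewrite d0.
Qed.

End Exponential.

(** * Additive characters of prime fields *)

Section PrimeField.
Variable q : nat.
Hypothesis hq : prime q.

Lemma Fp_intr_eq (a b : int) :
  (a%:~R == b%:~R :> 'F_q) = (a == b %[mod q%:Z])%Z.
Proof.
rewrite -subr_eq0 -rmorphB /= -(dvdz_pcharf (pchar_Fp hq)).
by rewrite eqz_mod_dvd.
Qed.

Lemma Fp_val_intr (x : 'F_q) : (Posz (x : nat))%:~R = x.
Proof. exact: natr_Zp. Qed.

Lemma Fp_intr_eq0 (a : int) : (a%:~R == 0 :> 'F_q) = (q%:Z %| a)%Z.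
Proof. by rewrite -(dvdz_pcharf (pchar_Fp hq)). Qed.

Lemma Fp_intr_addM (a b : int) : (a + b * q%:Z)%:~R = a%:~R :> 'F_q.
Proof.
apply/eqP; rewrite Fp_intr_eq eqz_mod_dvd; apply/dvdzP; exists b; ring.
Qed.

Lemma Fp_val_intr_mod (a : int) : (Posz (a%:~R : 'F_q) = a %[mod q%:Z])%Z.
Proof. by apply/eqP; rewrite -Fp_intr_eq Fp_val_intr. Qed.

Lemma Fp_val_lt (x : 'F_q) : (x < q)%N.
Proof. by rewrite -[X in (_ < X)%N](Fp_cast hq); exact: ltn_ord. Qed.

End PrimeField.

Section AdditiveCharacters.
Context {R : realType}.
Variable q : nat.
Hypothesis hq : prime q.
Let q0 : (0 < q)%N := prime_gt0 hq.

Definition addchar (x : 'F_q) (t : int) : R[i] := e ((Posz x * t)%:~R / q%:R).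

Lemma addchar_intr (a t : int) :
  addchar a%:~R t = e ((a * t)%:~R / q%:R).
Proof.
apply: e_eqmod => //; apply/eqP; rewrite -(Fp_intr_eq hq) !rmorphM /=.
by rewrite -[(Posz _)%:~R]/((Posz (a%:~R : 'F_q))%:~R) Fp_val_intr.
Qed.

Lemma addcharDl (x y : 'F_q) t : addchar (x + y) t = addchar x t * addchar y t.
Proof.
rewrite -[x in addchar (x + _)]Fp_val_intr -[y in addchar (_ + y)]Fp_val_intr.
by rewrite -rmorphD /= addchar_intr mulrDl rmorphD /= mulrDl eD.
Qed.

Lemma addcharDr (x : 'F_q) t s : addchar x (t + s) = addchar x t * addchar x s.
Proof. by rewrite /addchar mulrDr rmorphD /= mulrDl eD. Qed.

Lemma conj_addchar (x : 'F_q) t : conjc (addchar x t) = addchar x (- t).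
Proof. by rewrite /addchar conj_e mulrN rmorphN /= mulNr. Qed.

Lemma addcharNl (x : 'F_q) t : addchar (- x) t = conjc (addchar x t).
Proof.
rewrite conj_addchar -[x in LHS]Fp_val_intr -mulrNz addchar_intr.
by rewrite /addchar mulrN mulNr.
Qed.

Lemma cabs2_addchar (x : 'F_q) t : cabs2 (addchar x t) = 1.
Proof. exact: cabs2_e. Qed.

Lemma sum_addchar (t : int) :
  \sum_x addchar x t = (if (q%:Z %| t)%Z then q%:R else 0 : R)%:C.
Proof.
case: ifP => [qt|nqt].
  rewrite (eq_bigr (fun=> 1)) => [|x _]; last first.
    by apply/eqP; rewrite e_eq1 // dvdz_mull.
  by rewrite sumr_const card_Fp // rmorph_nat.
(* Translating x by 1 multiplies the sum by [addchar 1 t], which is not 1 when q does not divide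
   t. *)
have /eqP : addchar 1 t * \sum_x addchar x t = \sum_x addchar x t.
  rewrite mulr_sumr [RHS](reindex_inj (addrI (1 : 'F_q))) /=.
  by apply: eq_bigr => x _; rewrite addcharDl.
rewrite -subr_eq0 -{2}[\sum_x _]mul1r -mulrBl mulf_eq0 subr_eq0 => /orP[|/eqP->//].
by rewrite -[1 : 'F_q]/(1%:~R) addchar_intr mul1r e_eq1 // nqt.
Qed.

End AdditiveCharacters.

Lemma sum_cabs2_expand (R : realType) (X I : finType) (Q : pred X) (P : pred I)
    (chi : X -> I -> R[i]) (c : I -> R[i]) :
  (\sum_(x | Q x) cabs2 (\sum_(i | P i) c i * chi x i))%:C =
  \sum_(i | P i) \sum_(i' | P i') c i * conjc (c i') *
     \sum_(x | Q x) chi x i * conjc (chi x i').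
Proof.
have E x : (cabs2 (\sum_(i | P i) c i * chi x i))%:C =
    \sum_(i | P i) \sum_(i' | P i') c i * conjc (c i') * (chi x i * conjc (chi x i')).
  rewrite -mul_conj conj_sum mulr_suml; apply: eq_bigr => i _.
  rewrite mulr_sumr; apply: eq_bigr => i' _; rewrite conjcM; ring.
rewrite RtoC_sum (eq_bigr _ (fun x _ => E x)) exchange_big /=.
apply: eq_bigr => i _; rewrite exchange_big /=; apply: eq_bigr => i' _.
by rewrite mulr_sumr.
Qed.

(* The relation [D i i'] marks the pairs of phases that fail to be orthogonal. *)
Lemma sum_cabs2_orth_le (R : realType) (X I : finType) (P : pred I) (D : rel I)
    (chi : X -> I -> R[i]) (c : I -> R[i]) (K : R) (m : nat) :
  0 <= K -> (forall i, cabs2 (c i) <= 1) ->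
  (forall i i', P i -> P i' ->
     \sum_x chi x i * conjc (chi x i') = (if D i i' then K else 0)%:C) ->
  (forall i, P i -> (#|[pred i' | P i' && D i i']| <= m)%N) ->
  \sum_x cabs2 (\sum_(i | P i) c i * chi x i) <= K * #|P|%:R * m%:R.
Proof.
move=> K0 c1 H cm.
rewrite -[leLHS]/(complex.Re (_%:C)) sum_cabs2_expand.
have -> : K * #|P|%:R * m%:R = \sum_(i | P i) K * m%:R.
  by rewrite sumr_const -mulr_natr; ring.
rewrite Re_sum; apply: ler_sum => i Pi; rewrite Re_sum.
apply: (@le_trans _ _ (\sum_(i' | P i' && D i i') K)); last first.
  rewrite sumr_const -[leLHS]mulr_natr ler_wpM2l // ler_nat; exact: cm.
rewrite big_mkcondr /=; apply: ler_sum => i' Pi'; rewrite H //.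
case: ifP => _; last by rewrite mulr0.
set z := c i * _.
have z1 : cabs2 z <= 1.
  rewrite /z cabs2M cabs2_conj -[leRHS]mulr1.
  by rewrite ler_pM // cabs2_ge0.
have : complex.Re z <= 1.
  have := le_trans (Re_sqr_le z) z1; move: (complex.Re z) => u; nra.
case: z {z1} => u v /= u1; rewrite mulr0 subr0; nra.
Qed.

(** * Reduction to residue classes *)

(* The phase [e(n' n / q^2)], with the inverse [n'] taken in [0, q); it is set
   to [0] when [q] divides [n]. *)
Definition twist {R : realType} (q : nat) (n : int) : R[i] :=
  if (n%:~R : 'F_q) == 0 then 0
  else e ((Posz (n%:~R : 'F_q)^-1%R * n)%:~R / (q ^ 2)%:R).

Section SpecialCharacters.
Context {R : realType}.
Variable q : nat.
Hypothesis hq : prime q.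
Let q0 : (0 < q)%N := prime_gt0 hq.

Lemma dirichlet_char_eqmod (m : nat) (chi : int -> R[i]) (a b : int) :
  dirichlet_char m chi -> (a = b %[mod m%:Z])%Z -> chi a = chi b.
Proof.
move=> [per _ _ _] /eqP; rewrite eqz_mod_dvd => /dvdzP[k E].
have pern (j : nat) c : chi (c + j%:Z * m%:Z) = chi c.
  elim: j c => [|j IH] c; first by rewrite mul0r addr0.
  by rewrite -(IH c) -[RHS]per; congr chi; rewrite -addn1 PoszD; ring.
have -> : a = b + k * m%:Z by rewrite -E; ring.
case: k {E} => k; first exact: pern.
by rewrite -[LHS](pern k.+1); congr chi; rewrite NegzE; ring.
Qed.

Lemma coprimez_sqr (n : int) : coprime `|n|%N (q ^ 2) = ((n%:~R : 'F_q) != 0).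
Proof.
rewrite (Fp_intr_eq0 hq) dvdzE /= coprime_sym coprime_pexpl //.
by rewrite prime_coprime.
Qed.

Lemma Fp_inv_mul (n : int) : (n%:~R : 'F_q) != 0 ->
  (Posz (n%:~R : 'F_q)^-1%R * n = 1 %[mod q%:Z])%Z.
Proof.
by move=> n0; apply/eqP; rewrite -(Fp_intr_eq hq) intrM Fp_val_intr mulVf.
Qed.

(** This removes from [xi] its phase at the representative of [b] in [0, q). What is left of [xi]
    depends only on the class modulo [q]. *)
Definition reduced_char (xi : int -> R[i]) (b : 'F_q) : R[i] :=
  xi (Posz b) * conjc (e ((Posz b^-1%R * Posz b)%:~R / (q ^ 2)%:R)).

(** Let b represent n and let i invert b modulo q. Then n = b (1 + i (n - b)) modulo q^2, since q
    divides both b i - 1 and n - b. Membership in [G1] gives xi(1 + i (n - b)) = e(i (n - b) / q^2),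
    which is the ratio of the two phases. *)
Lemma G1_factor (xi : int -> R[i]) (n : int) : G1 q xi ->
  xi n = reduced_char xi n%:~R * twist q n.
Proof.
move=> [xiD xi1]; rewrite /twist; case: ifPn => [n0|n0].
  by case: xiD => _ _ _ -> //; rewrite ?mulr0 // coprimez_sqr negbK.
rewrite /reduced_char conj_e -mulrA -eD.
set b := n%:~R : 'F_q; set i := b^-1%R.
have bn : (Posz b = n %[mod q%:Z])%Z by exact: Fp_val_intr_mod.
have ib : (Posz i * Posz b = 1 %[mod q%:Z])%Z.
  by rewrite /i -modzMmr bn modzMmr; exact: Fp_inv_mul.
have [k kE] : exists k, n - Posz b = k * q%:Z.
  by apply/dvdzP; rewrite -eqz_mod_dvd; apply/eqP.
have [l lE] : exists l, Posz i * Posz b - 1 = l * q%:Z.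
  by apply/dvdzP; rewrite -eqz_mod_dvd; apply/eqP.
have -> : - ((Posz i * Posz b)%:~R / (q ^ 2)%:R) + (Posz i * n)%:~R / (q ^ 2)%:R =
   ((1 + Posz i * (n - Posz b)) - 1)%:~R / (q ^ 2)%:R :> R.
  rewrite -mulNr -mulrDl -mulrNz -rmorphD /=; congr (_%:~R / _); ring.
rewrite -xi1; last first.
  rewrite kE mulrA; apply/eqP; rewrite eqz_mod_dvd; apply/dvdzP.
  by exists (Posz i * k); ring.
case: (xiD) => _ <- _ _; apply: (dirichlet_char_eqmod xiD).
apply/eqP; rewrite eqz_mod_dvd; apply/dvdzP; exists (- (l * k)).
rewrite PoszM; have -> : n = Posz b + k * q%:Z by rewrite -kE; ring.
have H : Posz b * Posz i = 1 + l * q%:Z by rewrite -lE; ring.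
transitivity ((1 - Posz b * Posz i) * k * q%:Z); first ring.
by rewrite H; ring.
Qed.

(** By Euler's theorem n^phi(q) is 1 modulo q, so xi(n)^phi(q) is a value of [e] and has modulus
    1. *)
Lemma G1_cabs2 (xi : int -> R[i]) (n : int) : G1 q xi -> (n%:~R : 'F_q) != 0 -> cabs2 (xi n) = 1.
Proof.
move=> [xiD xi1] n0.
have xiX m : xi (n ^+ m) = xi n ^+ m.
  case: xiD => _ xM x1 _; elim: m => [|m IH]; first by rewrite !expr0.
  by rewrite !exprS xM IH.
have : cabs2 (xi n) ^+ totient q = 1.
  have cX m : cabs2 (xi n) ^+ m = cabs2 (xi n ^+ m).
    elim: m => [|m IH]; first by rewrite !expr0 /cabs2 /= expr1n expr0n addr0.
    by rewrite !exprS cabs2M IH.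
  rewrite cX -xiX xi1 ?cabs2_e //; apply/eqP; rewrite -(Fp_intr_eq hq) rmorphXn /=.
  set b := n%:~R : 'F_q; rewrite -(natr_Zp b) -natrX.
  have bq : coprime b q.
    rewrite coprime_sym -unitFpE // natr_Zp unitfE; exact: n0.
  by rewrite -(Fp_nat_mod hq) (Euler_exp_totient bq) Fp_nat_mod.
move/eqP; rewrite pexpr_eq1 ?cabs2_ge0 ?totient_gt0 //; first by move/eqP.
Qed.

(** In the product of [xi] and the conjugate of [xi'] the phases cancel. The product is a character
    modulo q, whose sum vanishes when it is nontrivial. *)
Lemma reduced_charP (xi xi' : int -> R[i]) : G1 q xi -> G1 q xi' ->
  \sum_b reduced_char xi b * conjc (reduced_char xi' b) =
  (if `[< xi = xi' >] then (totient q)%:R else 0 : R)%:C.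
Proof.
move=> G G'; have [xiD _] := G; have [xiD' _] := G'.
have E b : reduced_char xi b * conjc (reduced_char xi' b) =
    xi (Posz b) * conjc (xi' (Posz b)).
  rewrite /reduced_char conjcM conjcK.
  set z := e _; rewrite mulrACA [_ * z]mulrC mul_conj /z cabs2_e; exact: mulr1.
rewrite (eq_bigr _ (fun b _ => E b)).
have x0 (b : 'F_q) : b = 0 -> xi (Posz b) = 0.
  move=> b0; case: xiD => _ _ _ -> //.
  by rewrite coprimez_sqr negbK Fp_val_intr b0.
case: asboolP => [<-|ne].
  rewrite (bigD1 0) // (x0 0 erefl) mul0r /= add0r.
  rewrite (eq_bigr (fun=> 1)) => [|b b0]; last first.
    by rewrite mul_conj G1_cabs2 // Fp_val_intr.
  rewrite sumr_const rmorph_nat; congr _%:R.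
  by rewrite cardC1 card_Fp // totient_prime.
have [n nE] : exists n, xi n <> xi' n.
  apply: contrapT => H; apply: ne; apply/funext => n.
  by apply: contrapT => h; apply: H; exists n.
have n0 : (n%:~R : 'F_q) != 0.
  apply: contra_not_neq nE => n0.
  by case: xiD => _ _ _ ->; rewrite ?coprimez_sqr ?negbK ?n0 //; case: xiD' => _ _ _ ->; rewrite ?coprimez_sqr ?negbK ?n0.
(* [f] depends only on the class modulo [q], because [xi] and [xi'] carry the same factor
   [twist]. *)
pose f (m : int) := xi m * conjc (xi' m).
have fmod (m : int) : f (Posz (m%:~R : 'F_q)) = f m.
  rewrite /f (G1_factor (Posz _) G) (G1_factor (Posz _) G') Fp_val_intr.
  rewrite (G1_factor m G) (G1_factor m G') !conjcM.
  suff H : (twist q (Posz (m%:~R : 'F_q)) : R[i]) * conjc (twist q (Posz (m%:~R : 'F_q))) =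
           twist q m * conjc (twist q m).
    by rewrite mulrACA H mulrACA.
  rewrite !mul_conj /twist Fp_val_intr; case: ifP => // _.
  by rewrite !cabs2_e.
(* Multiplication by n permutes the residues and scales the sum by [f n], which differs from 1. *)
have S : f n * \sum_(b : 'F_q) f (Posz b) = \sum_(b : 'F_q) f (Posz b).
  have inj : injective (fun b : 'F_q => n%:~R * b) by exact: mulfI.
  rewrite mulr_sumr [RHS](reindex_inj inj).
  apply: eq_bigr => b _; rewrite -[RHS]/(f (Posz (n%:~R * b)%R)).
  have -> : n%:~R * b = (n * Posz b)%:~R :> 'F_q by rewrite intrM Fp_val_intr.
  rewrite fmod /f; case: xiD => _ -> _ _; case: xiD' => _ -> _ _.
  by rewrite conjcM mulrACA.
have fn1 : f n != 1.
  apply: contra_not_neq nE => fn1.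
  have : f n * xi' n = xi' n by rewrite fn1 mul1r.
  by rewrite /f -mulrA [conjc _ * _]mulrC mul_conj G1_cabs2 // => <-; rewrite mulr1.
move/eqP: S; rewrite -subr_eq0 -{2}[\sum_b _]mul1r -mulrBl mulf_eq0 subr_eq0.
by rewrite (negbTE fn1) => /eqP.
Qed.

(** Bessel's inequality: grouped by residue, the inner sum pairs the class sums with
    [reduced_char xi]. These vectors are orthogonal of squared norm phi(q), which cancels the
    denominator; [duality] transfers the bound. *)
Lemma G1_sum_le (I : finType) (pt : I -> int) (a : I -> R[i]) :
  q%:R / (totient q)%:R * \sum_(xi \in @G1 R q) cabs2 (\sum_k a k * xi (pt k)) <=
  q%:R * \sum_(b : 'F_q) cabs2 (\sum_(k | (pt k)%:~R == b) a k * twist q (pt k)).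
Proof.
have t0 : 0 < (totient q)%:R :> R by rewrite ltr0n totient_gt0.
rewrite -mulrA ler_wpM2l // mulrC ler_pdivrMr // mulrC.
set c := fun b : 'F_q => \sum_(k | (pt k)%:~R == b) a k * twist q (pt k).
have cE xi : G1 q xi ->
    \sum_k a k * xi (pt k) = \sum_b c b * reduced_char xi b.
  move=> G; rewrite (partition_big (fun k => (pt k)%:~R : 'F_q) xpredT) //=.
  apply: eq_bigr => b _; rewrite mulr_suml; apply: eq_bigr => k /eqP kb.
  by rewrite (G1_factor _ G) kb; ring.
(* The sum over [G1] runs over the finite support of its summand and is 0 by default when that
   support is infinite. Otherwise [X] is a finite set of characters in [G1]. *)
case: finite_supportP => [_|X XG _ _].
  rewrite big_nil mulr_ge0 ?(ltW t0) // sumr_ge0 // => b _; exact: cabs2_ge0.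
have G (x : X) : G1 q (val x) by apply: XG; exact: valP.
rewrite big_seq_fsetE /=.
suff H (y : X -> R[i]) :
    \sum_b cabs2 (\sum_x (1 : R)%:C * y x * reduced_char (val x) b) <=
    (totient q)%:R * \sum_x 1 * cabs2 (y x).
  have := @duality R X 'F_q (totient q)%:R (fun=> 1)
    (fun x b => reduced_char (val x) b) (ltW t0) (fun=> ler01) H c.
  by under [X in X <= _ -> _]eq_bigr do rewrite mul1r -cE //.
under [X in X <= _]eq_bigr do under eq_bigr do rewrite mul1r.
under [X in _ <= _ * X]eq_bigr do rewrite mul1r.
rewrite -[leLHS]/(complex.Re (_%:C)) sum_cabs2_expand.
rewrite Re_sum mulr_sumr; apply: ler_sum => x _.
rewrite (bigD1 x) //= [X in _ + X]big1 => [|x' nx]; last first.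
  rewrite [X in _ * X](reduced_charP (G x) (G x')); case: asboolP => [/val_inj xx'|_]; last by rewrite mulr0.
  by rewrite xx' eqxx in nx.
rewrite addr0 [X in _ * X](reduced_charP (G x) (G x)); case: asboolP => // _.
by rewrite mul_conj -rmorphM /= mulrC.
Qed.

End SpecialCharacters.

(** * Cross terms *)

Section Frame.
Context {R : realType}.

Lemma sum_nat_le_sqr (Q : nat) (P : pred 'I_Q.+1) :
  \sum_(q | P q) (q%:R : R) <= Q%:R ^+ 2.
Proof.
apply: (@le_trans _ _ (\sum_(q < Q.+1) (q%:R : R))).
  by rewrite big_mkcond; apply: ler_sum => q _; case: ifP => // _; exact: ler0n.
have -> : Q%:R ^+ 2 = \sum_(i < Q) Q%:R :> R.
  by rewrite sumr_const card_ord expr2 mulr_natr.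
rewrite big_ord_recl add0r /=.
by apply: ler_sum => i _; rewrite ler_nat.
Qed.

(** Almost orthogonality: when the square is opened, [delta] controls the diagonal. Off it, AM-GM
    replaces the geometric mean of [A q] and [A q'] by half their sum, and the free sum over the
    other prime costs at most Q^2. *)
Lemma frame_le (Q : nat) (P : pred 'I_Q.+1) (T : finType)
    (Y : 'I_Q.+1 -> T -> R[i]) (A : 'I_Q.+1 -> R) (delta beta : R) :
  0 <= beta -> (forall q, 0 <= A q) ->
  (forall q, P q -> q%:R * \sum_i cabs2 (Y q i) <= delta * A q) ->
  (forall q q', P q -> P q' -> q != q' ->
     cabs2 (\sum_i Y q i * conjc (Y q' i)) <= beta ^+ 2 * (A q * A q')) ->
  \sum_i cabs2 (\sum_(q | P q) (q%:R : R)%:C * Y q i) <=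
    (delta + Q%:R ^+ 2 * beta) * \sum_(q | P q) q%:R * A q.
Proof.
move=> b0 A0 Hdiag Hoff.
rewrite -[leLHS]/(complex.Re (_%:C)) sum_cabs2_expand Re_sum.
pose f (q q' : 'I_Q.+1) : R := q%:R * q'%:R * beta * ((A q + A q') / 2).
have term q q' : P q -> P q' ->
    complex.Re ((q%:R : R)%:C * conjc (q'%:R : R)%:C * \sum_i Y q i * conjc (Y q' i))
    <= (if q == q' then q%:R * (delta * A q) else 0) + f q q'.
  move=> Pq Pq'.
  have f0 : 0 <= f q q'.
    by rewrite /f !mulr_ge0 ?addr_ge0 ?invr_ge0 ?ler0n // ?A0.
  rewrite conjc_real -rmorphM /=.
  have ReZ (u : R) z : complex.Re (u%:C * z) = u * complex.Re z.
    by case: z => a b /=; ring.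
  rewrite ReZ; move: f0; have [<-|ne] := eqVneq q q' => f0.
    apply: (@le_trans _ _ (q%:R * (delta * A q))); last by rewrite lerDl.
    rewrite -mulrA ler_wpM2l //; apply: le_trans (Hdiag q Pq).
    rewrite Re_sum ler_wpM2l //; apply: ler_sum => i _.
    by rewrite mul_conj.
  rewrite add0r /f -[leRHS]mulrA ler_wpM2l ?mulr_ge0 //.
  have := Hoff _ _ Pq Pq' ne; set z := \sum_i _ => zH.
  have : 2 * complex.Re z <= beta * A q + beta * A q'.
    apply: ler_AMGM; rewrite ?mulr_ge0 //.
    by apply: le_trans (Re_sqr_le z) _; apply: le_trans zH _; lra.
  by lra.
apply: le_trans (_ : _ <= \sum_(q | P q) \sum_(q' | P q')
   ((if q == q' then q%:R * (delta * A q) else 0) + f q q')) _.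
  apply: ler_sum => q Pq; rewrite Re_sum; apply: ler_sum => q' Pq'; exact: term.
under eq_bigr do rewrite big_split /=.
rewrite big_split /= mulrDl; apply: lerD.
  rewrite mulr_sumr; apply: ler_sum => q Pq.
  rewrite (bigD1 q) //= eqxx big1 => [|q' /andP[_ /negbTE]]; last by rewrite eq_sym => ->.
  by lra.
have E : \sum_(q | P q) \sum_(q' | P q') f q q' =
    beta * ((\sum_(q | P q) (q%:R : R)) * (\sum_(q | P q) q%:R * A q)).
  have E1 : \sum_(q | P q) \sum_(q' | P q') f q q' =
     beta / 2 * (\sum_(q | P q) \sum_(q' | P q') q%:R * A q * q'%:R
       + \sum_(q | P q) \sum_(q' | P q') q%:R * (q'%:R * A q')).
    rewrite -big_split /= mulr_sumr; apply: eq_bigr => q _.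
    rewrite -big_split /= mulr_sumr; apply: eq_bigr => q' _; rewrite /f; ring.
  by rewrite E1 -!big_distrlr /=; field.
rewrite E [leRHS]mulrAC mulrC ler_wpM2r // ler_wpM2r ?sum_nat_le_sqr //.
by rewrite sumr_ge0 // => q _; rewrite mulr_ge0.
Qed.

Lemma sum_sigFp (V : nmodType) (Q : nat) (F : {q : 'I_Q.+1 & 'F_q} -> V) :
  \sum_t F t = \sum_(q < Q.+1) \sum_(b : 'F_q) F (Tagged (fun q : 'I_Q.+1 => 'F_q) b).
Proof.
rewrite (@sig_big_dep _ _ _ 'I_Q.+1 (fun q : 'I_Q.+1 => 'F_q) xpredT (fun _ => xpredT)
  (fun (q : 'I_Q.+1) (b : 'F_q) => F (Tagged (fun q : 'I_Q.+1 => 'F_q) b))) /=.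
by apply: eq_bigr => -[].
Qed.

(** [duality] on the pairs (q, b), with weight q for selected q and 0 otherwise. At a given point
    only the class b containing it contributes, so the dual sum runs over q alone. *)
Lemma twisted_duality (Q : nat) (P : pred 'I_Q.+1) (T : finType) (pt : T -> int) (B : R) :
  0 <= B ->
  (forall y : forall q : 'I_Q.+1, 'F_q -> R[i],
    \sum_i cabs2 (\sum_(q | P q) (q%:R : R)%:C * (y q (pt i)%:~R * twist q (pt i))) <=
    B * \sum_(q | P q) q%:R * \sum_b cabs2 (y q b)) ->
  forall a : T -> R[i],
  \sum_(q | P q) q%:R * \sum_(b : 'F_q)
     cabs2 (\sum_(i | (pt i)%:~R == b) a i * twist q (pt i)) <=
  B * \sum_i cabs2 (a i).
Proof.
move=> B0 H a.
pose J := {q : 'I_Q.+1 & 'F_q}.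
pose tg (q : 'I_Q.+1) (b : 'F_q) : J := Tagged (fun q : 'I_Q.+1 => 'F_q) b.
pose w (t : J) : R := if P (tag t) then (tag t)%:R else 0.
pose v (t : J) (i : T) : R[i] :=
  if (pt i)%:~R == tagged t then twist (tag t) (pt i) else 0.
have w0 t : 0 <= w t by rewrite /w; case: ifP.
have D := @duality R J T B w v B0 w0 _ a.
apply: le_trans (D _) => {D}.
  rewrite sum_sigFp /=.
  rewrite [leLHS]big_mkcond /=; apply: ler_sum => q _; rewrite /w /=.
  case: ifP => Pq; last by rewrite big1 // => b _; rewrite mul0r.
  rewrite mulr_sumr; apply: ler_sum => b _; rewrite /v /=.
  rewrite big_mkcond ler_wpM2l //.
  rewrite (eq_bigr (fun i => a i * (if (pt i)%:~R == b then twist q (pt i) else 0))) //.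
  by move=> i _; case: ifP; rewrite ?mulr0.
move=> y; have H' := H (fun q b => y (tg q b)).
apply: (le_trans _ (le_trans H' _)).
  rewrite le_eqVlt; apply/orP; left; apply/eqP; apply: eq_bigr => i _; congr cabs2.
  rewrite sum_sigFp /=.
  rewrite [RHS]big_mkcond /=; apply: eq_bigr => q _; rewrite /w /v /=.
  case: ifP => Pq; last by rewrite big1 // => b _; rewrite !mul0r.
  rewrite (bigD1 ((pt i)%:~R)) //= eqxx big1 => [|b nb]; last first.
    by rewrite eq_sym (negbTE nb) mulr0.
  by rewrite addr0 mulrA.
rewrite ler_wpM2l //.
rewrite sum_sigFp /=.
rewrite [leLHS]big_mkcond /=; apply: ler_sum => q _; rewrite /w /=.
case: ifP => Pq; last by rewrite big1 // => b _; rewrite mul0r.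
by rewrite mulr_sumr.
Qed.

End Frame.

(** * One prime: shifts and class sums *)

Section OnePrime.
Context {R : realType}.
Variable q : nat.
Hypothesis hq : prime q.
Let q0 : (0 < q)%N := prime_gt0 hq.

Lemma Fp_addl_eqmod (c : int) (i j : nat) :
  (c + i%:Z)%:~R = (c + j%:Z)%:~R :> 'F_q -> (i = j %[mod q])%N.
Proof.
by move=> /eqP; rewrite (Fp_intr_eq hq) eqz_modDl !modz_nat => /eqP[].
Qed.

Lemma Fp_subl_eqmod (c : int) (i j : nat) :
  (c - i%:Z)%:~R = (c - j%:Z)%:~R :> 'F_q -> (i = j %[mod q])%N.
Proof.
move=> /eqP; rewrite (Fp_intr_eq hq) eqz_mod_dvd.
have -> : c - i%:Z - (c - j%:Z) = j%:Z - i%:Z by ring.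
by rewrite -eqz_mod_dvd eq_sym !modz_nat => /eqP[].
Qed.

(** Adding m q leaves the inverse n' modulo q unchanged, so the phase n' n / q^2 grows by n' m /
    q. *)
Lemma twist_addMq (n m : int) :
  twist q (n + m * q%:Z) = twist q n * addchar (n%:~R : 'F_q)^-1%R m :> R[i].
Proof.
rewrite /twist Fp_intr_addM //; case: ifP => _; first by rewrite mul0r.
rewrite /addchar -eD; congr e.
have qn0 : q%:R != 0 :> R by rewrite pnatr_eq0 -lt0n.
rewrite natrX !rmorphM /= rmorphD rmorphM /= -[(q : int)%:~R]/(q%:R).
by field.
Qed.

Lemma cabs2_twist_le1 n : cabs2 (twist q n : R[i]) <= 1.
Proof. by rewrite /twist; case: ifP => _; rewrite ?cabs20 ?cabs2_e. Qed.

(** Cauchy-Schwarz in each class, which has at most N / q + 1 members. *)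
Lemma residue_sums_le (N : nat) (M : int) (a : 'I_N -> R[i]) :
  q%:R * \sum_(b : 'F_q)
     cabs2 (\sum_(k < N | (M + k%:Z)%:~R == b) a k * twist q (M + k%:Z)) <=
  (N + q)%:R * \sum_k cabs2 (a k).
Proof.
have -> : \sum_k cabs2 (a k) =
    \sum_(b : 'F_q) \sum_(k < N | (M + k%:Z)%:~R == b) cabs2 (a k).
  by rewrite (partition_big (fun k : 'I_N => (M + k%:Z)%:~R : 'F_q) xpredT).
rewrite !mulr_sumr; apply: ler_sum => b _.
have A0 : 0 <= \sum_(k < N | (M + k%:Z)%:~R == b) cabs2 (a k).
  by apply: sumr_ge0 => k _; exact: cabs2_ge0.
apply: (@le_trans _ _ (q%:R * ((\sum_(k < N | (M + k%:Z)%:~R == b) cabs2 (a k)) *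
    (N %/ q + 1)%:R))).
  rewrite ler_wpM2l //; apply: le_trans (cabs2_CS _ _ _ _) _.
  rewrite ler_wpM2l //.
  apply: (@le_trans _ _ (\sum_(k < N | (M + k%:Z)%:~R == b) 1)).
    by apply: ler_sum => k _; exact: cabs2_twist_le1.
  rewrite sumr_const ler_nat; apply: card_mod_le => // i j ib jb.
  apply: (@Fp_addl_eqmod M).
  by rewrite (eqP (ib : (M + i%:Z)%:~R == b)) (eqP (jb : (M + j%:Z)%:~R == b)).
rewrite mulrCA -natrM [leRHS]mulrC ler_wpM2l // ler_nat mulnDr muln1 leq_add2r.
by rewrite mulnC leq_divM.
Qed.

End OnePrime.

(** * Two distinct primes: joint residues *)

Section TwoPrimes.
Context {R : realType}.
Variables q q' : nat.
Hypotheses (hq : prime q) (hq' : prime q') (qq' : q != q').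
Let q0 : (0 < q)%N := prime_gt0 hq.
Let q0' : (0 < q')%N := prime_gt0 hq'.
Let r := (q * q')%N.

Lemma coprime_primes : coprime q q'.
Proof. by rewrite prime_coprime // dvdn_prime2. Qed.

Lemma Fp_pair_eqmod (c : int) (i j : nat) :
  (c + i%:Z)%:~R = (c + j%:Z)%:~R :> 'F_q ->
  (c + i%:Z)%:~R = (c + j%:Z)%:~R :> 'F_q' -> (i = j %[mod r])%N.
Proof.
move=> /(Fp_addl_eqmod hq) E /(Fp_addl_eqmod hq') E'.
by apply/eqP; rewrite chinese_remainder ?coprime_primes // E E' !eqxx.
Qed.

(** By the Chinese remainder theorem a pair of residues fixes a class modulo [r], which the range
    meets at most [K %/ r + 1] times. *)
Lemma sum_pair_le (K : nat) (c : int) (F : 'F_q -> 'F_q' -> R) :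
  (forall b b', 0 <= F b b') ->
  \sum_(i < K) F (c + i%:Z)%:~R (c + i%:Z)%:~R <=
    (K %/ r + 1)%:R * \sum_b \sum_b' F b b'.
Proof.
move=> F0; rewrite pair_big /=.
apply: (@sum_fiber_le R _ _ xpredT
  (fun i : 'I_K => ((c + i%:Z)%:~R : 'F_q, (c + i%:Z)%:~R : 'F_q')) _
  (fun t => F t.1 t.2)) => // -[b b'].
apply: card_mod_le => [|i j /eqP[ib ib'] /eqP[jb jb']]; first by rewrite muln_gt0 q0.
by apply: (@Fp_pair_eqmod c); rewrite ?ib ?jb ?ib' ?jb'.
Qed.

Lemma sum_mul_pair_le (K : nat) (c : int) (y : 'F_q -> R[i]) (y' : 'F_q' -> R[i]) :
  \sum_(i < K) cabs2 (y (c + i%:Z)%:~R) * cabs2 (y' (c + i%:Z)%:~R) <=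
    (K %/ r + 1)%:R * ((\sum_b cabs2 (y b)) * (\sum_b cabs2 (y' b))).
Proof.
apply: le_trans (sum_pair_le (F := fun b b' => cabs2 (y b) * cabs2 (y' b')) _ _ _) _.
  by move=> b b'; rewrite mulr_ge0 ?cabs2_ge0.
by rewrite big_distrlr.
Qed.

Lemma dvdz_Mq (t : int) : (q%:Z %| t * q'%:Z)%Z = (q%:Z %| t)%Z.
Proof. by rewrite Gauss_dvdzl // coprimezE /= coprime_primes. Qed.

(* Parseval on [F_q * F_q'], whose characters separate residues modulo [q q']. *)
Lemma sum_pair_addchar_le (S : nat) :
  \sum_(x : 'F_q) \sum_(x' : 'F_q') cabs2 (\sum_(s < S)
      (addchar x (s%:Z * q'%:Z) * conjc (addchar x' (s%:Z * q%:Z)) : R[i])) <=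
  r%:R * S%:R * (S %/ r + 1)%:R.
Proof.
rewrite pair_big /=.
pose chi (x : 'F_q * 'F_q') (s : 'I_S) : R[i] :=
  addchar x.1 (s%:Z * q'%:Z) * conjc (addchar x.2 (s%:Z * q%:Z)).
rewrite (eq_bigr (fun x => cabs2 (\sum_(s < S) 1 * chi x s))) => [|x _]; last first.
  by congr cabs2; apply: eq_bigr => s _; rewrite mul1r.
have cS : #|(xpredT : pred 'I_S)| = S by rewrite -[RHS]card_ord; exact: eq_card.
have := @sum_cabs2_orth_le R _ _ xpredT (fun s s' : 'I_S => (s == s' %[mod r])%N)
  chi (fun=> 1) r%:R (S %/ r + 1); rewrite cS; apply=> //.
- by move=> i; rewrite /cabs2 /= expr1n expr0n addr0.
- move=> s s' _ _.
  have E (x : 'F_q * 'F_q') :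
     addchar x.1 (s%:Z * q'%:Z) * conjc (addchar x.2 (s%:Z * q%:Z)) *
     conjc (addchar x.1 (s'%:Z * q'%:Z) * conjc (addchar x.2 (s'%:Z * q%:Z)))
     = (addchar x.1 ((s%:Z - s'%:Z) * q'%:Z) : R[i]) * addchar x.2 ((s'%:Z - s%:Z) * q%:Z).
    rewrite conjcM conjcK !conj_addchar mulrACA -!addcharDr; congr (_ * _); congr addchar; ring.
  under eq_bigr do rewrite E.
  rewrite -(pair_big xpredT xpredT (fun x x' => addchar x ((s%:Z - s'%:Z) * q'%:Z) *
     addchar x' ((s'%:Z - s%:Z) * q%:Z))) /=.
  rewrite -big_distrlr /= !sum_addchar // dvdz_Mq.
  have -> : (q'%:Z %| (s'%:Z - s%:Z) * q%:Z)%Z = (q'%:Z %| (s'%:Z - s%:Z))%Z.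
    by rewrite Gauss_dvdzl // coprimezE /= coprime_sym coprime_primes.
  have -> : (q%:Z %| s%:Z - s'%:Z)%Z = (s == s' %[mod q])%N.
    by rewrite -eqz_mod_dvd !modz_nat.
  have -> : (q'%:Z %| s'%:Z - s%:Z)%Z = (s == s' %[mod q'])%N.
    by rewrite -eqz_mod_dvd !modz_nat eq_sym.
  rewrite -rmorphM /= chinese_remainder ?coprime_primes //.
  by case: eqP => _; case: eqP => _; rewrite /= ?mulr0 ?mul0r // /r natrM.
- move=> s _; apply: card_mod_le => [|i j /eqP si /eqP sj]; first by rewrite muln_gt0 q0.
  by rewrite -si -sj.
Qed.

End TwoPrimes.

Lemma sum_ord_mul (V : nmodType) (g : nat -> V) (S r : nat) :
  \sum_(k < S * r) g k = \sum_(s < S) \sum_(i < r) g (s * r + i)%N.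
Proof.
elim: S => [|S IH]; first by rewrite !big_ord0.
rewrite big_ord_recr /= -IH -!(big_mkord xpredT g) mulSnr.
rewrite (@big_cat_nat _ _ _ (S * r)) ?leq_addr //=; congr (_ + _).
rewrite -{1}[(S * r)%N]add0n big_addn addKn big_mkord.
by apply: eq_bigr => i _; rewrite addnC.
Qed.

Lemma sum_ord_divmod (V : nmodType) (g : nat -> V) (N r : nat) :
  \sum_(k < N) g k =
  \sum_(i < r) \sum_(s < N %/ r) g (s * r + i)%N +
  \sum_(i < N %% r) g (N %/ r * r + i)%N.
Proof.
rewrite exchange_big -sum_ord_mul /= -!(big_mkord xpredT g).
rewrite (@big_cat_nat _ _ _ (N %/ r * r)) ?leq_divM //=; congr (_ + _).
rewrite -{1}[(N %/ r * r)%N]add0n big_addn big_mkord.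
have -> : (N - N %/ r * r = N %% r)%N by rewrite {1}(divn_eq N r) addKn.
by apply: eq_bigr => i _; rewrite addnC.
Qed.

(** * Cross terms on long intervals *)

Section Long.
Context {R : realType}.
Variables q q' : nat.
Hypotheses (hq : prime q) (hq' : prime q') (qq' : q != q').
Let q0 : (0 < q)%N := prime_gt0 hq.
Let q0' : (0 < q')%N := prime_gt0 hq'.
Let r := (q * q')%N.

(** Write k = s r + i. Cauchy-Schwarz over i separates the coefficients from the sums over s, whose
    energy is at most r S (S / r + 1) <= S^2 + N by Parseval. The incomplete last block costs r. *)
Lemma offdiag_long (N : nat) (M : int) (y : 'F_q -> R[i]) (y' : 'F_q' -> R[i]) :
  cabs2 (\sum_(k < N) y (M + k%:Z)%:~R * twist q (M + k%:Z) *
     conjc (y' (M + k%:Z)%:~R * twist q' (M + k%:Z))) <=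
  (8 * ((N %/ r) ^ 2 + N + r))%:R *
    ((\sum_b cabs2 (y b)) * (\sum_b cabs2 (y' b))).
Proof.
have r0 : (0 < r)%N by rewrite muln_gt0 q0.
set AA := (X in _ <= _ * X); set S := (N %/ r)%N.
have AA0 : 0 <= AA by rewrite mulr_ge0 // sumr_ge0 // => b _; exact: cabs2_ge0.
pose g (k : nat) : R[i] := y (M + k%:Z)%:~R * twist q (M + k%:Z) *
     conjc (y' (M + k%:Z)%:~R * twist q' (M + k%:Z)).
rewrite -[X in cabs2 X]/(\sum_(k < N) g k) (sum_ord_divmod g N r) -/S.
pose u (k : nat) : R := cabs2 (y (M + k%:Z)%:~R) * cabs2 (y' (M + k%:Z)%:~R).
have u0 k : 0 <= u k by rewrite mulr_ge0 ?cabs2_ge0.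
have gu k : cabs2 (g k) <= u k.
  rewrite /g cabs2M cabs2_conj !cabs2M mulrACA -/(u k).
  rewrite ler_piMr // mulr_ile1 ?cabs2_ge0 ?cabs2_twist_le1 //.
pose H (x : 'F_q) (x' : 'F_q') : R := cabs2 (\sum_(s < S)
      (addchar x (s%:Z * q'%:Z) * conjc (addchar x' (s%:Z * q%:Z)) : R[i])).
have main : cabs2 (\sum_(i < r) \sum_(s < S) g (s * r + i)%N) <=
    (4 * (S ^ 2 + N))%:R * AA.
  apply: (@le_trans _ _ ((\sum_(i < r) u i) *
     (\sum_(i < r) H (M + i%:Z)%:~R^-1%R (M + i%:Z)%:~R^-1%R))).
    apply: cabs2_sum_le => [i _|i _|i _]; [exact: u0 | exact: cabs2_ge0 |].
    set n := M + i%:Z.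
    (* The shift s r is s q' times q and s q times q', so both twists turn into additive characters
       in s. *)
    have E (s : nat) : g (s * r + i)%N = g i *
        (addchar (n%:~R : 'F_q)^-1%R (s%:Z * q'%:Z) *
         conjc (addchar (n%:~R : 'F_q')^-1%R (s%:Z * q%:Z))).
      have e1 : M + (s * r + i)%N%:Z = n + (s%:Z * q'%:Z) * q%:Z.
        by rewrite /n /r !(PoszD, PoszM); ring.
      have e2 : M + (s * r + i)%N%:Z = n + (s%:Z * q%:Z) * q'%:Z.
        by rewrite /n /r !(PoszD, PoszM); ring.
      rewrite /g {1 2}e1 e2 !twist_addMq // !Fp_intr_addM // !conjcM -/n.
      ring.
    under eq_bigr do rewrite E; rewrite -mulr_sumr cabs2M.
    by rewrite ler_wpM2r ?cabs2_ge0.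
  (* The factor 2 is [r %/ r + 1]. *)
  have B1 : \sum_(i < r) u i <= 2 * AA.
    have := sum_mul_pair_le hq hq' qq' r M y y'.
    by rewrite divnn r0.
  have B2 : \sum_(i < r) H (M + i%:Z)%:~R^-1%R (M + i%:Z)%:~R^-1%R <=
      2 * (S ^ 2 + N)%:R.
    have := sum_pair_le hq hq' qq' r M
      (F := fun b b' => H b^-1%R b'^-1%R) (fun _ _ => cabs2_ge0 _).
    rewrite divnn r0 => /le_trans; apply; rewrite ler_wpM2l //.
    (* Inversion, with 0 sent to 0, permutes each field, so the frequencies range over all pairs. *)
    rewrite (reindex_inj invr_inj) /=.
    apply: (@le_trans _ _ (\sum_x \sum_x' H x x')).
      apply: ler_sum => x _; rewrite (reindex_inj invr_inj) /=.
      by apply: ler_sum => x' _; rewrite !invrK.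
    apply: le_trans (sum_pair_addchar_le hq hq' qq' S) _.
    rewrite -!natrM ler_nat -/r mulnDr muln1 -mulnA [(S * _)%N]mulnC mulnA.
    have := leq_divM S r; have := leq_divM N r; rewrite -/S; nia.
  apply: le_trans (ler_pM _ _ B1 B2) _.
  - by apply: sumr_ge0.
  - by apply: sumr_ge0 => i _; exact: cabs2_ge0.
  by rewrite natrM; lra.
have rem : cabs2 (\sum_(i < N %% r) g (S * r + i)%N) <= r%:R * AA.
  apply: le_trans (cabs2_sum_card _ _) _.
  apply: ler_pM => //; first by apply: sumr_ge0 => i _; exact: cabs2_ge0.
    rewrite ler_nat (leq_trans (max_card _)) // card_ord ltnW // ltn_mod //.
  apply: (@le_trans _ _ (\sum_(i < N %% r) u (S * r + i)%N)).
    by apply: ler_sum => i _; exact: gu.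
  (* The block is shorter than r, so each pair of residues occurs at most once. *)
  have := sum_mul_pair_le hq hq' qq' (N %% r) (M + (S * r)%N%:Z) y y'.
  rewrite divn_small ?ltn_mod // mul1r; apply: le_trans.
  by apply: ler_sum => i _; rewrite /u PoszD addrA.
apply: le_trans (cabs2D_le _ _) _.
apply: le_trans (ler_wpM2l _ (lerD main rem)) _ => //.
rewrite -mulrDl mulrA ler_wpM2r // -natrD -natrM ler_nat.
by rewrite mulnDr mulnA [leqRHS]mulnDr leq_add2l leq_mul2r orbT.
Qed.

End Long.

(** * Cross terms on short intervals *)

Lemma sum_window (V : nmodType) (h : nat -> V) (L s K : nat) :
  (L <= s < K)%N ->
  \sum_(v < L) h v = \sum_(z < K | (z <= s < z + L)%N) h (s - z)%N.
Proof.
move=> /andP[Ls sK]; case: L Ls => [|L] Ls.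
  by rewrite big_ord0 big_pred0 // => z; apply/negbTE; lia.
have lt (v : 'I_L.+1) : (s - v < K)%N by lia.
pose f (v : 'I_L.+1) := Ordinal (lt v).
rewrite (reindex_onto f (fun z : 'I_K => inord (s - z))) /=; last first.
  move=> z /andP[zs sz]; apply: val_inj => /=; rewrite inordK; lia.
apply: eq_big => [v|v _]; last by congr h; have := ltn_ord v; lia.
have vL := ltn_ord v; apply/esym/andP; split; first lia.
by apply/eqP/val_inj => /=; rewrite inordK; lia.
Qed.

Lemma card_near_le (K c w : nat) :
  (#|[pred h : 'I_K | (h <= c + w) && (c <= h + w)]| <= 2 * w + 1)%N.
Proof.
rewrite cardE -(size_map val) -(size_iota (c - w) (2 * w + 1)).
apply: uniq_leq_size; first by rewrite (map_inj_uniq val_inj) enum_uniq.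
by move=> x /mapP[h]; rewrite mem_enum inE mem_iota => H -> /=; lia.
Qed.

(** Two applications of Cauchy-Schwarz: over u to remove [Z], then over pairs (k, k') to remove [X].
    Hence the fourth power in the hypothesis. *)
Lemma bilinear_le (R : realType) (K U : finType) (J : pred K) (P : pred U)
    (Phi : K -> U -> R[i]) (X : K -> R[i]) (Z : U -> R[i]) (beta : R) :
  \sum_(k | J k) \sum_(k' | J k')
    cabs2 (\sum_(u | P u) Phi k u * conjc (Phi k' u)) <= beta ^+ 4 ->
  cabs2 (\sum_(k | J k) \sum_(u | P u) X k * Z u * Phi k u) <=
  beta ^+ 2 * ((\sum_(k | J k) cabs2 (X k)) * (\sum_(u | P u) cabs2 (Z u))).
Proof.
move=> H; set SX := \sum_(k | J k) cabs2 _; set SZ := \sum_(u | P u) cabs2 _.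
have SX0 : 0 <= SX by apply: sumr_ge0 => *; exact: cabs2_ge0.
have SZ0 : 0 <= SZ by apply: sumr_ge0 => *; exact: cabs2_ge0.
set T := \sum_(u | P u) cabs2 (\sum_(k | J k) X k * Phi k u).
have T0 : 0 <= T by apply: sumr_ge0 => *; exact: cabs2_ge0.
apply: (@le_trans _ _ (SZ * T)).
  rewrite exchange_big /=; apply: le_trans (cabs2_CS _ _ _ _).
  rewrite le_eqVlt; apply/orP; left; apply/eqP; congr cabs2.
  apply: eq_bigr => u _; rewrite mulr_sumr; apply: eq_bigr => k _; ring.
rewrite [SX * _]mulrC mulrCA ler_wpM2l //.
have b0 : 0 <= beta ^+ 2 * SX by rewrite mulr_ge0 ?sqr_ge0.
rewrite -(@ler_sqr R) ?nnegrE // -[leLHS]cabs2_real /T sum_cabs2_expand pair_big /=.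
apply: le_trans (cabs2_CS _ _ _ _) _.
rewrite exprMn mulrC -exprM; apply: ler_pM.
- by apply: sumr_ge0 => *; exact: cabs2_ge0.
- by apply: sumr_ge0 => *; exact: cabs2_ge0.
- by rewrite pair_big in H.
rewrite expr2 big_distrlr pair_big /=; apply: ler_sum => -[k k'] _ /=.
by rewrite cabs2M cabs2_conj.
Qed.

Section Short.
Context {R : realType}.
Variables q q' : nat.
Hypotheses (hq : prime q) (hq' : prime q') (qq' : q != q').
Let q0 : (0 < q)%N := prime_gt0 hq.
Let q0' : (0 < q')%N := prime_gt0 hq'.
Let r := (q * q')%N.

Let q'F : (q'%:Z%:~R : 'F_q) != 0.
Proof. by rewrite (Fp_intr_eq0 hq) dvdzE /= dvdn_prime2. Qed.

(* [1/k - 1/(k-h) = j] is a quadratic equation in [k]. *)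
Lemma inverse_difference_inj (s k1 k2 l1 l2 : 'F_q) :
  s != 0 -> k1 != 0 -> k2 != 0 -> l1 != 0 -> l2 != 0 -> k1 != k2 ->
  k1 - k2 = l1 - l2 -> (k1 * s)^-1 - (k2 * s)^-1 = (l1 * s)^-1 - (l2 * s)^-1 ->
  l1 = k1 \/ l1 = - k2.
Proof.
move=> s0 k10 k20 l10 l20 k12 E1 E2.
have E3 : (k2 - k1) * (l1 * l2) = (l2 - l1) * (k1 * k2).
  have -> : k2 - k1 = ((k1 * s)^-1 - (k2 * s)^-1) * (k1 * k2 * s) by field; rewrite s0 k20 k10.
  have -> : l2 - l1 = ((l1 * s)^-1 - (l2 * s)^-1) * (l1 * l2 * s) by field; rewrite s0 l20 l10.
  by rewrite E2; ring.
have E4 : l2 = l1 - (k1 - k2) by rewrite E1; ring.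
have : (k2 - k1) * ((l1 - k1) * (l1 + k2)) = 0.
  have -> : (l1 - k1) * (l1 + k2) = l1 * (l1 - (k1 - k2)) - k1 * k2 by ring.
  rewrite -E4 mulrBr E3 E4; ring.
move/eqP; rewrite !mulf_eq0 subr_eq0 eq_sym (negbTE k12) /= subr_eq0 addr_eq0.
by move=> /orP[/eqP|/eqP]; [left|right].
Qed.

Section Block.
Variables (L : nat) (c : int).

Let U : pred 'I_L := [pred u : 'I_L | (c - u%:Z)%:~R == 0 :> 'F_q].
Let t (u : 'I_L) : int := ((c - u%:Z) %/ q%:Z)%Z.
(** With m = c - u = t q, this is the part of the phase at n = k q' + m that involves k and m
    jointly: (k q')' t / q from the prime q, and -m' k / q' from the conjugated factor of q'. *)
Let Phi (k : 'F_q) (u : 'I_L) : R[i] :=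
  addchar (k * q'%:Z%:~R)^-1%R (t u) *
  conjc (addchar ((c - u%:Z)%:~R : 'F_q')^-1%R (Posz k)).

Lemma card_U : (#|U| <= L %/ q + 1)%N.
Proof.
apply: card_mod_le => // i j iU jU; apply: (@Fp_subl_eqmod _ hq c).
by rewrite (eqP (iU : _ == _)) (eqP (jU : _ == _)).
Qed.

Lemma t_eq u : U u -> t u * q%:Z = c - u%:Z.
Proof. by move=> Uu; rewrite /t divzK // -(Fp_intr_eq0 hq). Qed.

(** Parseval modulo q: two terms interact only if t u = t u' modulo q, that is u = u' modulo q^2,
    which leaves at most L / q^2 + 1 partners for each u. *)
Lemma sum_Phi_le (d : nat -> R[i]) : (forall u, cabs2 (d u) <= 1) ->
  \sum_(j : 'F_q) cabs2 (\sum_(u | U u) d u * addchar j (t u)) <=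
  (q * (L %/ q + 1) * (L %/ q ^ 2 + 1))%:R.
Proof.
move=> d1; apply: le_trans (_ : q%:R * #|U|%:R * (L %/ q ^ 2 + 1)%:R <= _); last first.
  by rewrite -!natrM ler_nat leq_mul2r leq_mul2l card_U !orbT.
apply: (@sum_cabs2_orth_le R _ _ U (fun u u' => (q%:Z %| t u - t u')%Z)
  (fun (j : 'F_q) u => addchar j (t u)) (fun u : 'I_L => d u)) => // [u u' _ _|u Uu].
  rewrite -(sum_addchar hq); apply: eq_bigr => x _.
  by rewrite conj_addchar -addcharDr.
apply: card_mod_le => [|i j /andP[Ui di] /andP[Uj dj]]; first by rewrite expn_gt0 q0.
have [a aE] : exists a, t i - t j = a * q%:Z.
  apply/dvdzP; have -> : t i - t j = (t u - t j) - (t u - t i) by ring.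
  by rewrite rpredB.
have : ((c - i%:Z) - (c - j%:Z)) = a * (q ^ 2)%N%:Z.
  rewrite -!t_eq // -mulrBl aE expnS expn1 PoszM; ring.
have -> : c - i%:Z - (c - j%:Z) = j%:Z - i%:Z by ring.
move=> H; have : ((q ^ 2)%N%:Z %| j%:Z - i%:Z)%Z by rewrite H dvdz_mull.
by rewrite -eqz_mod_dvd eq_sym !modz_nat => /eqP[].
Qed.

(** The diagonal is bounded trivially. For distinct k, k' the inner sum depends only on h = k - k'
    and on the frequency j = (k q')' - (k' q')'. Each (h, j) arises at most twice, the window
    condition leaves few h, and [sum_Phi_le] handles all j for fixed h. *)
Lemma sum_Psi_le (J : pred 'F_q) :
  (forall k, J k -> k != 0) ->
  (forall k k', J k -> J k' -> k * q' < k' * q' + L)%N ->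
  \sum_(k | J k) \sum_(k' | J k')
    cabs2 (\sum_(u | U u) Phi k u * conjc (Phi k' u)) <=
  (q * (L %/ q + 1) ^ 2 +
   2 * minn (2 * q) (2 * (L %/ q') + 1) * (q * (L %/ q + 1) * (L %/ q ^ 2 + 1)))%:R.
Proof.
move=> J0 HJ; set w := (L %/ q')%N; pose s := q'%:Z%:~R : 'F_q.
pose psi k k' : R := cabs2 (\sum_(u | U u) Phi k u * conjc (Phi k' u)).
(* Differences are stored as k - k' + q, a natural number below 2q; [near] then says |k - k'| <=
   w. *)
pose d (h u : nat) : R[i] :=
  conjc (addchar ((c - u%:Z)%:~R : 'F_q')^-1%R (h%:Z - q%:Z)).
pose near := [pred h : 'I_(2 * q) | (h <= q + w) && (q <= h + w)]%N.
pose F (p : 'I_(2 * q) * 'F_q) : R := if near p.1 then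
  cabs2 (\sum_(u | U u) d p.1 u * addchar p.2 (t u)) else 0.
have F0 p : 0 <= F p by rewrite /F; case: ifP => // _; exact: cabs2_ge0.
have hlt (k k' : 'F_q) : (k + q - k' < 2 * q)%N.
  by have := Fp_val_lt hq k; lia.
pose phi (p : 'F_q * 'F_q) : 'I_(2 * q) * 'F_q :=
  (Ordinal (hlt p.1 p.2), (p.1 * s)^-1 - (p.2 * s)^-1).
have hE (k k' : 'F_q) : (k + q - k')%N%:Z - q%:Z = Posz k - Posz k'.
  by have := Fp_val_lt hq k'; lia.
have psiF k k' : J k -> J k' -> psi k k' = F (phi (k, k')).
  move=> Jk Jk'; have Hk := HJ _ _ Jk Jk'; have Hk' := HJ _ _ Jk' Jk.
  have -> : F (phi (k, k')) = cabs2 (\sum_(u | U u) d (k + q - k')%N u *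
      addchar ((k * s)^-1 - (k' * s)^-1) (t u)).
    rewrite /F ifT //=.
    have h1 : (k - k' <= w)%N by rewrite leq_divRL // mulnBl; lia.
    have h2 : (k' - k <= w)%N by rewrite leq_divRL // mulnBl; lia.
    by have := Fp_val_lt hq k'; lia.
  congr cabs2; apply: eq_bigr => u _.
  rewrite /Phi /d conjcM conjcK hE [addchar (_ - _) _]addcharDl //.
  rewrite [addchar (- _) _]addcharNl // addcharDr -[addchar _ (- _)]conj_addchar conjcM conjcK; ring.
have diag k : psi k k <= ((L %/ q + 1) ^ 2)%:R.
  apply: le_trans (cabs2_sum_card _ _) _.
  rewrite (eq_bigr (fun=> 1)) => [|u _]; last first.
    by rewrite cabs2M cabs2_conj /Phi cabs2M cabs2_conj !cabs2_addchar !mulr1.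
  by rewrite sumr_const -natrM ler_nat -mulnn leq_mul // card_U.
have cardq : #|J|%:R <= q%:R :> R.
  by rewrite ler_nat -[leqRHS](card_Fp hq) max_card.
rewrite -/(psi _ _).
under eq_bigr => k Jk do rewrite -/(psi _ _) (bigD1 k) //=.
rewrite big_split /= natrD; apply: lerD.
  apply: (@le_trans _ _ (\sum_(k | J k) ((L %/ q + 1) ^ 2)%:R)).
    by apply: ler_sum => k _; exact: diag.
  by rewrite sumr_const -[leLHS]mulr_natl natrM ler_wpM2r.
rewrite pair_big_dep /=.
rewrite (eq_bigr (fun p => F (phi p))) => [|[k k'] /andP[Jk /andP[Jk' _]]]; last first.
  by rewrite -psiF.
apply: (@le_trans _ _ (2%:R * \sum_p F p)).
  apply: sum_fiber_le => // -[h j].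
  set S := [pred p | _ & _].
  case: (pickP S) => [[k1 k2] /= S1|S0]; last by rewrite eq_card0.
  (* A fibre holds (k1, k2) and at most its mirror (-k2, -k1): the quadratic leaves two values for
     l1, and the difference then fixes l2. *)
  have sub : S \subset [:: (k1, k2); (- k2, - k1)].
    apply/fintype.subsetP => -[l1 l2] /= S2; rewrite !inE.
    case/andP: S1 => /andP[J1 /andP[J2 n12]] /eqP p1.
    case/andP: S2 => /andP[J1' /andP[J2' _]] /eqP p2.
    have pE : phi (l1, l2) = phi (k1, k2) by rewrite p1 p2.
    have h12 : (l1 + q - l2 = k1 + q - k2)%N := congr1 (fun p => nat_of_ord p.1) pE.
    have j12 : (l1 * s)^-1 - (l2 * s)^-1 = (k1 * s)^-1 - (k2 * s)^-1 := congr1 snd pE.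
    have h12' : l1 - l2 = k1 - k2.
      have -> : l1 - l2 = ((l1 + q - l2)%N%:Z - q%:Z)%:~R by rewrite hE rmorphB /= !Fp_val_intr.
      have -> : k1 - k2 = ((k1 + q - k2)%N%:Z - q%:Z)%:~R by rewrite hE rmorphB /= !Fp_val_intr.
      by rewrite h12.
    have k10 := J0 _ J1; have k20 := J0 _ J2.
    have l10 := J0 l1 J1'; have l20 := J0 l2 J2'.
    have E2 : l2 = l1 - (k1 - k2) by rewrite -h12'; ring.
    rewrite eq_sym in n12.
    case: (inverse_difference_inj q'F k10 k20 l10 l20 n12 (esym h12') (esym j12)) => E1.
      by rewrite E2 E1 opprB addrCA subrr addr0 eqxx.
    apply/orP; right; rewrite E2 E1; apply/eqP; congr (_, _); ring.
  by exact: leq_trans (subset_leq_card sub) (card_size _).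
rewrite -mulnA natrM ler_wpM2l // natrM.
rewrite -(pair_big xpredT xpredT (fun h j => F (h, j))) /=.
apply: (@le_trans _ _ (\sum_(h | near h) (q * (L %/ q + 1) * (L %/ q ^ 2 + 1))%:R)).
  rewrite [leRHS]big_mkcond /=; apply: ler_sum => h _; rewrite /F /=.
  case: ifP => _; last by rewrite big1.
  by apply: (@sum_Phi_le (d h)) => u; rewrite cabs2_conj cabs2_addchar.
rewrite sumr_const -[leLHS]mulr_natl ler_wpM2r // ler_nat leq_min card_near_le andbT.
by rewrite -[leqRHS]card_ord max_card.
Qed.

End Block.

Lemma sum_pair_rev_le (K : nat) (c : int) (F : 'F_q -> 'F_q' -> R) :
  (forall b b', 0 <= F b b') ->
  \sum_(i < K) F (c - i%:Z)%:~R (c - i%:Z)%:~R <=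
    (K %/ r + 1)%:R * \sum_b \sum_b' F b b'.
Proof.
move=> F0; apply: le_trans (sum_pair_le hq hq' qq' K (c - K%:Z + 1) F0).
rewrite (reindex_inj rev_ord_inj) /= le_eqVlt; apply/orP; left; apply/eqP.
apply: eq_bigr => i _; have iK := ltn_ord i.
by have -> : c - (K - i.+1)%N%:Z = c - K%:Z + 1 + i%:Z by lia.
Qed.

Let W (L : nat) (z : nat) (k : 'F_q) := (z <= k * q' + L < z + L)%N.
Let U (L : nat) (c : int) : pred 'I_L := [pred u : 'I_L | (c - u%:Z)%:~R == 0 :> 'F_q].

(* The Fejer-type weight [#{(u, v) | v - u = n}] is separated here: writing
   [n = k q' + m] with [q | m], the sum splits over the integers
   [z = k q' + L - v] into products of windows for [k] and for [m]. *)
Lemma sum_window_split (L : nat) (M : int) (g : int -> R[i]) :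
  \sum_(u < L) \sum_(v < L) g (M + v%:Z - u%:Z) =
  \sum_(z < L + r) \sum_(k | W L z k) \sum_(u < L | U (M + L%:Z - z%:Z) u)
    g (Posz k * q'%:Z + (M + L%:Z - z%:Z - u%:Z)).
Proof.
(* The integer n = M + v - u is charged to the only residue k for which q divides n - k q'. *)
pose h (k : 'F_q) (u v : nat) : R[i] :=
  if (M + v%:Z - u%:Z - Posz k * q'%:Z)%:~R == 0 :> 'F_q then g (M + v%:Z - u%:Z) else 0.
have E (u v : 'I_L) : g (M + v%:Z - u%:Z) = \sum_k h k u v.
  rewrite /h -big_mkcond /= (big_pred1 ((M + v%:Z - u%:Z)%:~R / q'%:Z%:~R)) // => k.
  rewrite rmorphB rmorphM /= -[(Posz k)%:~R]/((Posz k)%:~R : 'F_q) Fp_val_intr subr_eq0.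
  by rewrite eq_sym -(can2_eq (mulfK q'F) (divfK q'F)).
under eq_bigr do under eq_bigr do rewrite E.
under eq_bigr do rewrite exchange_big /=.
rewrite exchange_big /=.
rewrite [RHS](exchange_big_dep xpredT) //=; apply: eq_bigr => k _.
under [RHS]eq_bigr do rewrite big_mkcond /=.
rewrite [RHS]exchange_big /=; apply: eq_bigr => u _.
(* Since k < q, the point k q' + L lies in [L, L + r), so every shift z fits the outer range. *)
have kr : (L <= k * q' + L < L + r)%N.
  by rewrite leq_addl addnC ltn_add2l /r ltn_pmul2r // Fp_val_lt.
rewrite (sum_window (h k u) kr); apply: eq_bigr => z /andP[zs _].
rewrite /h.
have -> : M + (k * q' + L - z)%N%:Z - u%:Z - Posz k * q'%:Z = M + L%:Z - z%:Z - u%:Z.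
  by rewrite -subzn // PoszD PoszM; ring.
have -> : M + (k * q' + L - z)%N%:Z - u%:Z = Posz k * q'%:Z + (M + L%:Z - z%:Z - u%:Z).
  by rewrite -subzn // PoszD PoszM; ring.
by [].
Qed.

(** For each z the split sum is a bilinear form, bounded by [bilinear_le]. In the Cauchy-Schwarz
    over z that follows, each k lies in exactly L windows, and for each of the L values of u a
    residue pair (0, b') recurs at most (L + r) / r + 1 times. *)
Lemma offdiag_short (L : nat) (M : int) (y : 'F_q -> R[i]) (y' : 'F_q' -> R[i])
    (beta : R) :
  (q * (L %/ q + 1) ^ 2 +
   2 * minn (2 * q) (2 * (L %/ q') + 1) * (q * (L %/ q + 1) * (L %/ q ^ 2 + 1)))%:R
   <= beta ^+ 4 ->
  cabs2 (\sum_(u < L) \sum_(v < L)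
    y (M + v%:Z - u%:Z)%:~R * twist q (M + v%:Z - u%:Z) *
    conjc (y' (M + v%:Z - u%:Z)%:~R * twist q' (M + v%:Z - u%:Z))) <=
  beta ^+ 2 * (L ^ 2 * ((L + r) %/ r + 1))%:R *
    ((\sum_b cabs2 (y b)) * (\sum_b cabs2 (y' b))).
Proof.
move=> Hb; set s := q'%:Z%:~R : 'F_q.
rewrite (sum_window_split L M (fun n => y n%:~R * twist q n * conjc (y' n%:~R * twist q' n))).
set c := fun z : nat => M + L%:Z - z%:Z.
apply: (@le_trans _ _ (
  (\sum_(z < L + r) beta ^+ 2 * \sum_(k | W L z k) cabs2 (y (k * s))) *
  (\sum_(z < L + r) \sum_(u < L | U (c z) u) cabs2 (y' (c z - u%:Z)%:~R)))).
  apply: cabs2_sum_le => [z _|z _|z _].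
  - by rewrite mulr_ge0 ?sqr_ge0 // sumr_ge0 // => *; exact: cabs2_ge0.
  - by rewrite sumr_ge0 // => *; exact: cabs2_ge0.
  (* For k = 0 the integer n is a multiple of q, where [twist q] vanishes. *)
  pose J := [pred k | W L z k && (k != 0)].
  pose X (k : 'F_q) : R[i] := y (k * s) * twist q (Posz k * q'%:Z).
  pose Z (u : 'I_L) : R[i] := conjc (y' (c z - u%:Z)%:~R * twist q' (c z - u%:Z)).
  pose Phi (k : 'F_q) (u : 'I_L) : R[i] :=
    addchar (k * s)^-1%R (((c z - u%:Z) %/ q%:Z)%Z) *
    conjc (addchar ((c z - u%:Z)%:~R : 'F_q')^-1%R (Posz k)).
  have Fk (k : 'F_q) : (Posz k * q'%:Z)%:~R = k * s by rewrite intrM Fp_val_intr.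
  have gE (k : 'F_q) (u : 'I_L) : U (c z) u ->
      y (Posz k * q'%:Z + (c z - u%:Z))%:~R * twist q (Posz k * q'%:Z + (c z - u%:Z)) *
      conjc (y' (Posz k * q'%:Z + (c z - u%:Z))%:~R * twist q' (Posz k * q'%:Z + (c z - u%:Z)))
      = X k * Z u * Phi k u.
    move=> Uu; have tE := t_eq Uu; rewrite /X /Z /Phi.
    set t := ((c z - u%:Z) %/ q%:Z)%Z in tE *.
    (* For q the base point is k q', shifted by t q; for q' it is c z - u, shifted by k q'. *)
    have e2 : Posz k * q'%:Z + (c z - u%:Z) = (c z - u%:Z) + Posz k * q'%:Z by ring.
    rewrite {3 4}e2 twist_addMq // Fp_intr_addM // -{1 2}tE twist_addMq // Fp_intr_addM //.
    rewrite Fk !conjcM; ring.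
  have -> : \sum_(k | W L z k) \sum_(u < L | U (c z) u)
      (y (Posz k * q'%:Z + (c z - u%:Z))%:~R * twist q (Posz k * q'%:Z + (c z - u%:Z)) *
      conjc (y' (Posz k * q'%:Z + (c z - u%:Z))%:~R * twist q' (Posz k * q'%:Z + (c z - u%:Z))))
      = \sum_(k | J k) \sum_(u < L | U (c z) u) X k * Z u * Phi k u.
    rewrite [RHS]big_mkcondr /=; apply: eq_bigr => k _.
    under eq_bigr => u Uu do rewrite gE //.
    case: eqVneq => //= k0; rewrite big1 // => u _.
    by rewrite /X /twist Fk k0 mul0r eqxx mulr0 !mul0r.
  apply: le_trans (@bilinear_le R _ _ J (U (c z)) Phi X Z beta _) _.
    apply: le_trans Hb; apply: (@sum_Psi_le L (c z) J) => [k /andP[_ //]|k k'].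
    by move=> /andP[/andP[H1 H2] _] /andP[/andP[H3 H4] _]; lia.
  rewrite -mulrA ler_wpM2l ?sqr_ge0 //; apply: ler_pM.
  - by apply: sumr_ge0 => *; exact: cabs2_ge0.
  - by apply: sumr_ge0 => *; exact: cabs2_ge0.
  - rewrite big_mkcondr /=; apply: ler_sum => k _; case: ifP => _; last exact: cabs2_ge0.
    by rewrite /X cabs2M ler_piMr ?cabs2_ge0 ?cabs2_twist_le1.
  - apply: ler_sum => u _.
    by rewrite /Z cabs2_conj cabs2M ler_piMr ?cabs2_ge0 ?cabs2_twist_le1.
have S1 : \sum_(z < L + r) beta ^+ 2 * \sum_(k | W L z k) cabs2 (y (k * s)) =
    beta ^+ 2 * (L%:R * \sum_b cabs2 (y b)).
  rewrite -mulr_sumr; congr (_ * _); rewrite (exchange_big_dep xpredT) //=.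
  rewrite [in RHS](reindex_inj (mulIf q'F)) /= mulr_sumr; apply: eq_bigr => k _.
  have kr : (L <= k * q' + L < L + r)%N.
    by rewrite leq_addl addnC ltn_add2l /r ltn_pmul2r // Fp_val_lt.
  by rewrite -(sum_window (fun=> cabs2 (y (k * s))) kr) sumr_const card_ord mulr_natl.
have S2 : \sum_(z < L + r) \sum_(u < L | U (c z) u) cabs2 (y' (c z - u%:Z)%:~R) <=
    L%:R * (((L + r) %/ r + 1)%:R * \sum_b cabs2 (y' b)).
  under eq_bigr do rewrite big_mkcond /=.
  rewrite exchange_big /= mulr_natl -[X in _ *+ X]card_ord -sumr_const.
  apply: ler_sum => u _.
  (* Divisibility by q is encoded as residue 0, so that the count of residue pairs applies. *)
  pose F (b : 'F_q) (b' : 'F_q') := if b == 0 then cabs2 (y' b') else 0.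
  have F0 b b' : 0 <= F b b' by rewrite /F; case: ifP => // _; exact: cabs2_ge0.
  have FE : \sum_b \sum_b' F b b' = \sum_b' cabs2 (y' b').
    rewrite (bigD1 (0 : 'F_q)) //= [X in _ + X = _]big1 ?addr0 => [|b /negbTE nb].
      by apply: eq_bigr => b' _; rewrite /F eqxx.
    by rewrite big1 // => b' _; rewrite /F nb.
  have := sum_pair_rev_le (L + r) (M + L%:Z - u%:Z) F0.
  rewrite FE; apply: le_trans; rewrite le_eqVlt; apply/orP; left; apply/eqP.
  apply: eq_bigr => z _; rewrite /F /c /U /=.
  by have -> : M + L%:Z - z%:Z - u%:Z = M + L%:Z - u%:Z - z%:Z by ring.
rewrite S1.
apply: le_trans (ler_wpM2l _ S2) _.
  by rewrite mulr_ge0 ?sqr_ge0 // mulr_ge0 // sumr_ge0 // => *; exact: cabs2_ge0.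
rewrite natrM -mulnn natrM; lra.
Qed.

End Short.

(** * Dyadic ranges of primes *)

Lemma sum_residue_le (R : realType) (q : nat) (hq : prime q) (K : nat) (c : int)
    (F : 'F_q -> R) : (forall b, 0 <= F b) ->
  q%:R * \sum_(i < K) F (c + i%:Z)%:~R <= (K + q)%:R * \sum_b F b.
Proof.
move=> F0; apply: (@le_trans _ _ (q%:R * ((K %/ q + 1)%:R * \sum_b F b))).
  rewrite ler_wpM2l //; apply: (sum_fiber_le (P := xpredT)) => // b.
  apply: card_mod_le => [|i j ib jb]; first exact: prime_gt0.
  apply: (@Fp_addl_eqmod _ hq c).
  by rewrite (eqP (ib : (c + i%:Z)%:~R == b)) (eqP (jb : (c + j%:Z)%:~R == b)).
rewrite mulrA -natrM ler_wpM2r ?sumr_ge0 // ler_nat mulnDr muln1 leq_add2r.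
by rewrite mulnC leq_divM.
Qed.

(** Each point of the interval is M + v - u for at least N pairs: take any u < N and v = u + 1 + k,
    which stays below 2N. *)
Lemma sum_interval_Fejer (R : realType) (N : nat) (M : int) (F : int -> R) :
  (forall n, 0 <= F n) ->
  N%:R * \sum_(k < N) F (M + 1 + k%:Z) <=
  \sum_(u < 2 * N) \sum_(v < 2 * N) F (M + v%:Z - u%:Z).
Proof.
move=> F0; pose f u v := F (M + v%:Z - u%:Z).
have row u : (u < N)%N -> \sum_(k < N) F (M + 1 + k%:Z) <= \sum_(v < 2 * N) f u v.
  move=> uN; rewrite -(big_mkord xpredT (f u)).
  have nn m n : 0 <= \sum_(m <= v < n) f u v by apply: sumr_ge0 => v _; exact: F0.
  rewrite (@big_cat_nat _ _ _ (u + 1)) //=; last by lia.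
  rewrite (@big_cat_nat _ _ _ (u + 1 + N) (u + 1)) //=; [|lia|lia].
  rewrite -[X in _ <= _ + (X + _)](_ : \sum_(k < N) F (M + 1 + k%:Z) = _); last first.
    rewrite -{1}[(u + 1)%N]add0n big_addn addKn big_mkord; apply: eq_bigr => k _.
    rewrite /f; congr F; lia.
  have := nn 0 (u + 1)%N; have := nn (u + 1 + N)%N (2 * N)%N; lra.
rewrite -(big_mkord xpredT (fun u => \sum_(v < 2 * N) f u v)).
rewrite (@big_cat_nat _ _ _ N) //=; last by lia.
rewrite big_mkord -[leLHS]addr0; apply: lerD; last first.
  by apply: sumr_ge0 => u _; apply: sumr_ge0 => v _; exact: F0.
rewrite (_ : N%:R * _ = \sum_(u < N) \sum_(k < N) F (M + 1 + k%:Z)); last first.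
  by rewrite sumr_const card_ord mulr_natl.
by apply: ler_sum => u _; exact: row.
Qed.

(** Here X is Q, h is N / Q, m the minimum, d and d' the quotients of 2N by q and q', f is q times
    [2 * N %/ q ^ 2], and k is q. The terms add up to 195 X h^2, rounded up to 256 = 4^4 for the
    fourth root. *)
Lemma window_count_bound (R : realFieldType) (m d d' f k h X : R) :
  1 <= h -> 0 < X -> 0 <= m -> 0 <= d -> 0 <= f -> 0 <= k ->
  d <= 4 * h -> d' <= 4 * h -> m <= 2 * X -> m <= 2 * d' + 1 -> k <= X -> f <= d ->
  k * ((d + 1) * (d + 1)) + 2 * (m * (d + 1)) * (f + k) <= 256 * (X * (h * h)).
Proof.
move=> h1 X0 m0 d0 f0 k0 dh d'h m1 m2 kX fd.
have d10 : 0 <= d + 1 by rewrite addr_ge0.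
have D : d + 1 <= 5 * h by lra.
have T1 : k * ((d + 1) * (d + 1)) <= X * (5 * h * (5 * h)).
  by apply: ler_pM => //; [rewrite mulr_ge0 | apply: ler_pM].
have T2 : m * (d + 1) * f <= 2 * X * (5 * h) * (4 * h).
  apply: ler_pM => //; [by rewrite mulr_ge0 | by apply: ler_pM | lra].
have T3 : m * (d + 1) * k <= 9 * h * (5 * h) * X.
  by apply: ler_pM => //; [rewrite mulr_ge0 | apply: ler_pM => //; lra].
have Xh : 0 <= X * (h * h) by rewrite !mulr_ge0 //; lra.
lra.
Qed.

(** With w = N^(1/2) / Q this dominates the multiplicity in [offdiag_short] by a square, as the
    beta^2 of [frame_le] requires. *)
Lemma window_multiplicity_bound (R : realFieldType) (w z : R) :
  0 <= w -> z - 1 <= 8 * w ^+ 2 -> z + 1 <= (3 * (1 + w)) ^+ 2.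
Proof. nra. Qed.

Lemma half_range_mul (Q q q' : nat) :
  (Q < 2 * q)%N -> (Q < 2 * q')%N -> (Q ^ 2 <= 4 * (q * q'))%N.
Proof.
move=> Qq Qq'; rewrite -mulnn (leq_trans (leq_mul (ltnW Qq) (ltnW Qq'))) //.
by rewrite mulnACA.
Qed.

Section Dyadic.
Context {R : realType}.
Variables (Q N : nat) (M : int).
Let P : pred 'I_Q.+1 := [pred q : 'I_Q.+1 | prime q && (Q < 2 * q)%N].

Definition dyadic_sum (a : 'I_N -> R[i]) : R :=
  \sum_(q | P q) q%:R * \sum_(b : 'F_q)
     cabs2 (\sum_(k < N | (M + 1 + k%:Z)%:~R == b) a k * twist q (M + 1 + k%:Z)).

(* [x] and [y] stand for [Q^(1/8)] and [N^(1/4)], so that all bounds are polynomial. *)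
Variables x y : R.
Hypotheses (x1 : 1 <= x) (y1 : 1 <= y) (xQ : x ^+ 8 = Q%:R) (yN : y ^+ 4 = N%:R).

Lemma dyadic_sum_trivial a :
  dyadic_sum a <= (y ^+ 4 * x ^+ 8 + x ^+ 16) * \sum_k cabs2 (a k).
Proof.
have A0 : 0 <= \sum_k cabs2 (a k) by apply: sumr_ge0 => k _; exact: cabs2_ge0.
apply: (@le_trans _ _ (\sum_(q | P q) (N + Q)%:R * \sum_k cabs2 (a k))).
  apply: ler_sum => q /andP[pq _]; apply: le_trans (residue_sums_le pq _ _) _.
  by rewrite ler_wpM2r // ler_nat leq_add2l -ltnS.
rewrite sumr_const -[leLHS]mulr_natl.
have cP : (#|P| <= Q)%N.
  rewrite -[leqRHS](card_ord Q) -[leqRHS](card_codom (@lift_inj _ ord0)).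
  apply/subset_leq_card/fintype.subsetP => q /andP[pq _].
  have [j ->|q00] := unliftP ord0 q; first exact: codom_f.
  by rewrite q00 in pq.
have cP' : #|P|%:R <= x ^+ 8 by rewrite xQ ler_nat.
rewrite mulrA ler_wpM2r // natrD -xQ -yN.
apply: le_trans (ler_wpM2r _ cP') _; last lra.
by rewrite addr_ge0 // exprn_ge0 // (le_trans ler01).
Qed.

Let xp : 0 < x. Proof. exact: lt_le_trans x1. Qed.
Let yp : 0 < y. Proof. exact: lt_le_trans y1. Qed.

Lemma diag_le (q : 'I_Q.+1) (K : nat) (c : int) (f : 'F_q -> R[i]) : prime q ->
  q%:R * \sum_(i < K) cabs2 (f (c + i%:Z)%:~R * twist q (c + i%:Z)) <=
  (K + Q)%:R * \sum_b cabs2 (f b).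
Proof.
move=> pq; have S0 : 0 <= \sum_b cabs2 (f b).
  by apply: sumr_ge0 => *; exact: cabs2_ge0.
apply: (@le_trans _ _ ((K + q)%:R * \sum_b cabs2 (f b))); last first.
  by rewrite ler_wpM2r // ler_nat leq_add2l -ltnS.
apply: le_trans (sum_residue_le pq K c (fun b => cabs2_ge0 (f b))).
rewrite ler_wpM2l //; apply: ler_sum => i _.
by rewrite cabs2M ler_piMr ?cabs2_ge0 ?cabs2_twist_le1.
Qed.

(** [beta] majorizes the square root of 8 (S^2 + N + r), because S <= 4 N / Q^2 and r <= Q^2 <=
    N. *)
Lemma dyadic_sum_long a : x ^+ 16 <= y ^+ 4 ->
  dyadic_sum a <=
  (y ^+ 4 + x ^+ 8 + x ^+ 16 * (12 * y ^+ 4 / x ^+ 16 + 4 * y ^+ 2)) *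
     \sum_k cabs2 (a k).
Proof.
move=> xy; set beta := 12 * _ / _ + _.
have b0 : 0 <= beta.
  by rewrite /beta addr_ge0 ?mulr_ge0 ?invr_ge0 ?exprn_ge0 // ltW.
have xE : x ^+ 16 = Q%:R ^+ 2 by rewrite -xQ -exprM.
apply: twisted_duality => [|f].
  by rewrite !addr_ge0 // ?mulr_ge0 ?exprn_ge0 // ltW.
rewrite xE; apply: (@frame_le _ Q P _ (fun q (i : 'I_N) => f q (M + 1 + i%:Z)%:~R * twist q (M + 1 + i%:Z))
  (fun q => \sum_b cabs2 (f q b)) (y ^+ 4 + x ^+ 8) beta b0).
- by move=> q; apply: sumr_ge0 => *; exact: cabs2_ge0.
- by move=> q /andP[pq _]; rewrite xQ yN -natrD; exact: diag_le.
move=> q q' /andP[pq Pq] /andP[pq' Pq'] ne.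
apply: le_trans (offdiag_long pq pq' ne _ _ _ _) _.
rewrite ler_wpM2r ?mulr_ge0 ?sumr_ge0 // => [*|*|]; try exact: cabs2_ge0.
set r := (q * q')%N; set S := (N %/ r)%N.
have rQ : (r <= Q ^ 2)%N by rewrite /r -mulnn leq_mul // -ltnS.
have Qr : (Q ^ 2 <= 4 * r)%N by exact: half_range_mul.
have Sr : (S * r <= N)%N by exact: leq_divM.
have rQ' : r%:R <= x ^+ 16 by rewrite xE -natrX ler_nat.
have Qr' : x ^+ 16 <= 4 * r%:R by rewrite xE -natrX -natrM ler_nat.
have Sr' : S%:R * r%:R <= y ^+ 4 by rewrite yN -natrM ler_nat.
have S0 : 0 <= S%:R :> R by [].
have St : S%:R <= 4 * y ^+ 4 / x ^+ 16.
  rewrite ler_pdivlMr ?exprn_gt0 //.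
  have := ler_wpM2l S0 Qr'; lra.
rewrite natrM !natrD natrX -yN /beta.
have -> : 12 * y ^+ 4 / x ^+ 16 = 3 * (4 * y ^+ 4 / x ^+ 16) by lra.
set t := 4 * y ^+ 4 / x ^+ 16 in St *.
have t0 : 0 <= t by apply: le_trans St.
have SS : S%:R ^+ 2 <= t ^+ 2 by rewrite ler_sqr ?nnegrE.
have y20 : 0 <= y ^+ 2 by rewrite exprn_ge0 // ltW.
have y4E : y ^+ 4 = y ^+ 2 * y ^+ 2 by rewrite -exprD.
move: xy; rewrite y4E in Sr' * => xy.
have := mulr_ge0 t0 y20; move: (y ^+ 2) y20 xy Sr' => z z0 xy _ tz; nra.
Qed.

Lemma window_quotient_le (q : 'I_Q.+1) : P q -> ((2 * N %/ q)%N)%:R <= 4 * (y ^+ 4 / x ^+ 8).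
Proof.
move=> /andP[pq Pq]; rewrite mulrA ler_pdivlMr ?exprn_gt0 // xQ yN -!natrM ler_nat.
have := leq_divM (2 * N) q; nia.
Qed.

Lemma offdiag_constant_le (q q' : 'I_Q.+1) : P q -> P q' -> x ^+ 8 <= y ^+ 4 ->
  (q * (2 * N %/ q + 1) ^ 2 +
   2 * minn (2 * q) (2 * (2 * N %/ q') + 1) *
   (q * (2 * N %/ q + 1) * (2 * N %/ q ^ 2 + 1)))%:R
   <= (4 * y ^+ 2 / x ^+ 2) ^+ 4.
Proof.
move=> Pq Pq' xy; have dq := window_quotient_le Pq; have dq' := window_quotient_le Pq'.
case/andP: Pq => pq _; have q0 := prime_gt0 pq.
set m := minn _ _.
(* Both sides of the minimum serve: 2q against the part with [2 * N %/ q ^ 2], the other against the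
   remaining q. *)
have m1 : m%:R <= 2 * x ^+ 8.
  rewrite xQ -natrM ler_nat (leq_trans (geq_minl _ _)) // leq_mul2l -ltnS.
  by rewrite ltn_ord orbT.
have m2 : m%:R <= 2 * (2 * N %/ q')%N%:R + 1 :> R.
  by rewrite -natrM natr1 ler_nat -addn1 geq_minr.
have qX : q%:R <= x ^+ 8 by rewrite xQ ler_nat -ltnS.
have eq1 : (q * (2 * N %/ q ^ 2))%N%:R <= (2 * N %/ q)%N%:R :> R.
  rewrite ler_nat leq_divRL // (_ : q * _ * q = 2 * N %/ q ^ 2 * q ^ 2)%N.
    exact: leq_divM.
  by rewrite -mulnn; ring.
move: dq dq' m1 m2 qX eq1.
set d := (2 * N %/ q)%N; set d' := (2 * N %/ q')%N; set e2 := (2 * N %/ q ^ 2)%N.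
set h := y ^+ 4 / x ^+ 8; set X := x ^+ 8.
have X0 : 0 < X by rewrite exprn_gt0.
have h1 : 1 <= h by rewrite ler_pdivlMr ?mul1r.
have -> : (4 * y ^+ 2 / x ^+ 2) ^+ 4 = 256 * (X * (h * h)).
  by rewrite /h /X; field; rewrite gt_eqF.
have -> : (q * (d + 1) ^ 2 + 2 * m * (q * (d + 1) * (e2 + 1)))%:R =
    q%:R * ((d%:R + 1) * (d%:R + 1)) +
    2 * (m%:R * (d%:R + 1)) * ((q * e2)%N%:R + q%:R) :> R.
  by rewrite !(natrD, natrM, natrX); ring.
by move=> dq dq' m1 m2 qX eq1; apply: (@window_count_bound R _ _ d'%:R).
Qed.

(** The Fejer weight on L = 2N replaces the interval, and [frame_le] runs over the pairs (u, v). In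
    its constant, [beta0] comes from the bilinear bound and [gamma] from the multiplicity. Dividing
    by N gives the claim. *)
Lemma dyadic_sum_middle a : x ^+ 8 <= y ^+ 4 ->
  dyadic_sum a <=
  (4 * y ^+ 4 + 2 * x ^+ 8 + 24 * x ^+ 14 * y ^+ 2 + 24 * x ^+ 6 * y ^+ 4) *
     \sum_k cabs2 (a k).
Proof.
move=> xy; have xn (n : nat) : 0 < x ^+ n by rewrite exprn_gt0.
have yn (n : nat) : 0 < y ^+ n by rewrite exprn_gt0.
set L := (2 * N)%N.
have Lr : L%:R = 2 * y ^+ 4 by rewrite yN natrM.
pose beta0 := 4 * y ^+ 2 / x ^+ 2; pose gamma := 3 * (1 + y ^+ 2 / x ^+ 8).
have xn0 (n : nat) : 0 <= x ^+ n by exact: ltW.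
have yn0 (n : nat) : 0 <= y ^+ n by exact: ltW.
have b0 : 0 <= beta0 by apply: divr_ge0 => //; apply: mulr_ge0.
have g0 : 0 <= gamma.
  by apply: mulr_ge0 => //; apply: addr_ge0 => //; apply: divr_ge0.
pose beta := beta0 * L%:R * gamma.
have be0 : 0 <= beta by apply: mulr_ge0 => //; apply: mulr_ge0.
apply: twisted_duality => [|f].
  by rewrite !addr_ge0 //; do ?[apply: mulr_ge0 => //].
pose G (n : int) : R[i] := \sum_(q | P q) (q%:R : R)%:C * (f q n%:~R * twist q n).
have S0 : 0 <= \sum_(q | P q) q%:R * \sum_b cabs2 (f q b).
  by apply: sumr_ge0 => q _; rewrite mulr_ge0 // sumr_ge0 // => *; exact: cabs2_ge0.
rewrite -(ler_pM2l (yn 4)) {1}yN.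
apply: le_trans (@sum_interval_Fejer R N M (fun n => cabs2 (G n)) (fun n => cabs2_ge0 _)) _.
rewrite -/L pair_big /=.
pose pt (p : 'I_L * 'I_L) : int := M + p.2%:Z - p.1%:Z.
have := @frame_le R Q P ('I_L * 'I_L)%type (fun q p => f q (pt p)%:~R * twist q (pt p))
  (fun q => \sum_b cabs2 (f q b)) (L%:R * (L + Q)%:R) beta be0.
move=> H; apply: le_trans (H _ _ _) _ => {H}.
- by move=> q; apply: sumr_ge0 => *; exact: cabs2_ge0.
- move=> q /andP[pq _].
  rewrite -(pair_big xpredT xpredT (fun u v =>
     cabs2 (f q (pt (u, v))%:~R * twist q (pt (u, v))))) /= mulr_sumr.
  have -> (z : R) : L%:R * (L + Q)%:R * z = \sum_(u < L) (L + Q)%:R * z.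
    by rewrite sumr_const card_ord -mulrA mulr_natl.
  apply: ler_sum => u _.
  apply: le_trans (diag_le L (M - u%:Z) (f q) pq).
  rewrite ler_wpM2l //; apply: ler_sum => v _.
  by rewrite (_ : pt (u, v) = M - u%:Z + v%:Z) // /pt /=; ring.
- move=> q q' Pq Pq' ne; have /andP[pq Qq] := Pq; have /andP[pq' Qq'] := Pq'.
  rewrite -(pair_big xpredT xpredT (fun u v => f q (pt (u, v))%:~R * twist q (pt (u, v)) *
    conjc (f q' (pt (u, v))%:~R * twist q' (pt (u, v))))) /=.
  apply: le_trans (offdiag_short pq pq' ne M (f q) (f q') (offdiag_constant_le Pq Pq' xy)) _.
  rewrite ler_wpM2r ?mulr_ge0 ?sumr_ge0 // => [*|*|]; try exact: cabs2_ge0.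
  rewrite -/beta0 -/L /beta; set r := (q * q')%N.
  have -> : (beta0 * L%:R * gamma) ^+ 2 = beta0 ^+ 2 * (L%:R ^+ 2 * gamma ^+ 2) by ring.
  rewrite ler_wpM2l ?sqr_ge0 // natrM natrX ler_wpM2l ?sqr_ge0 //.
  have Qr : (Q ^ 2 <= 4 * r)%N by exact: half_range_mul.
  have := leq_divM (L + r) r; set d := ((L + r) %/ r)%N => dr.
  have r0 : 0 < r%:R :> R by rewrite ltr0n muln_gt0 !prime_gt0.
  have dr' : d%:R * r%:R <= 2 * y ^+ 4 + r%:R.
    by rewrite -Lr -natrM -natrD ler_nat.
  have Qr' : (x ^+ 8) ^+ 2 <= 4 * r%:R by rewrite xQ -natrX -natrM ler_nat.
  have t0 : 0 <= y ^+ 2 / x ^+ 8 by exact: divr_ge0.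
  rewrite natrD /gamma; move: t0; set t := y ^+ 2 / x ^+ 8 => t0.
  have tE : y ^+ 4 = t ^+ 2 * (x ^+ 8) ^+ 2.
    by rewrite -exprMn /t divfK ?gt_eqF // -exprM.
  have d1 : d%:R - 1 <= 8 * t ^+ 2.
    rewrite -(ler_pM2r r0) mulrBl mul1r lerBlDr; apply: le_trans dr' _.
    rewrite lerD2r tE; have := ler_wpM2l (sqr_ge0 t) Qr'; lra.
  exact: window_multiplicity_bound.
rewrite [leRHS]mulrA ler_wpM2r // natrD Lr -xQ.
have -> : y ^+ 4 * (4 * y ^+ 4 + 2 * x ^+ 8 + 24 * x ^+ 14 * y ^+ 2 + 24 * x ^+ 6 * y ^+ 4)
  = 2 * y ^+ 4 * (2 * y ^+ 4 + x ^+ 8) + (x ^+ 8) ^+ 2 * beta => //.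
by rewrite /beta /beta0 /gamma Lr; field; rewrite gt_eqF.
Qed.

(** The cuts x^3 and x^5 for y mark N = Q^(3/2) and N = Q^(5/2). In each range the bounds on y trade
    the large terms for y^3 x^11; 54 = 4 + 2 + 24 + 24 comes from the middle range. *)
Lemma dyadic_sum_le a :
  dyadic_sum a <= 54 * (y ^+ 4 * x ^+ 4 + y * x ^+ 16 + y ^+ 3 * x ^+ 11) *
     \sum_k cabs2 (a k).
Proof.
have xn m n : (m <= n)%N -> x ^+ m <= x ^+ n by exact: ler_weXn2l.
have yn m n : (m <= n)%N -> y ^+ m <= y ^+ n by exact: ler_weXn2l.
have xn0 (n : nat) : 0 <= x ^+ n by rewrite exprn_ge0 // ltW.
have yn0 (n : nat) : 0 <= y ^+ n by rewrite exprn_ge0 // ltW.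
have A0 : 0 <= \sum_k cabs2 (a k) by apply: sumr_ge0 => k _; exact: cabs2_ge0.
have mono (c u v : R) : 0 <= c -> u <= v -> c * u <= c * v.
  by move=> c0 uv; rewrite ler_wpM2l.
have yx m n : 0 <= y ^+ m * x ^+ n by rewrite mulr_ge0.
have [y3|/ltW y3] := leP y (x ^+ 3).
  apply: le_trans (dyadic_sum_trivial a) _; rewrite ler_wpM2r //.
  have := mono _ _ _ (yx 3 8) y3; have := mono _ _ _ (xn0 16) y1.
  have := yx 4 4; have := yx 1 16; have := yx 3 11; lra.
have [y5|/ltW y5] := leP y (x ^+ 5).
  apply: le_trans (dyadic_sum_middle a _) _.
    apply: le_trans (_ : (x ^+ 3) ^+ 4 <= _); first by rewrite -exprM xn.
    by apply: lerXn2r => //; rewrite nnegrE // ltW.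
  rewrite ler_wpM2r //.
  have := mono _ _ _ (yx 2 11) y3; have := mono _ _ _ (yx 3 6) y5.
  have := mono _ _ _ (yn0 4) (xn 0 4 isT); have := mono _ _ _ (xn0 16) y1.
  have := xn 8 16 isT.
  have := yx 4 4; have := yx 1 16; have := yx 3 11; lra.
have y16 : x ^+ 16 <= y ^+ 4.
  apply: le_trans (_ : (x ^+ 5) ^+ 4 <= _); first by rewrite -exprM xn.
  by apply: lerXn2r => //; rewrite nnegrE // ltW.
apply: le_trans (dyadic_sum_long a y16) _; rewrite ler_wpM2r //.
have -> : x ^+ 16 * (12 * y ^+ 4 / x ^+ 16 + 4 * y ^+ 2) = 12 * y ^+ 4 + 4 * (y ^+ 2 * x ^+ 16).
  by field; rewrite gt_eqF.
have := mono _ _ _ (yx 2 11) y5.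
have := mono _ _ _ (yn0 4) (xn 0 4 isT); have := mono _ _ _ (xn0 16) y1.
have := xn 8 16 isT.
have := yx 4 4; have := yx 1 16; have := yx 3 11; lra.
Qed.

End Dyadic.

(** The hypothesis gives x'^4 <= x^4 / sqrt 2, and 3/4 is a rational upper bound for 1 / sqrt 2.
    Every power of x is at least the fourth, so the whole bound shrinks geometrically. *)
Lemma root_halving (R : realFieldType) (x x' y : R) :
  0 <= x -> 0 <= x' -> 0 <= y -> 2 * x' ^+ 8 <= x ^+ 8 ->
  y ^+ 4 * x' ^+ 4 + y * x' ^+ 16 + y ^+ 3 * x' ^+ 11 <=
  3 / 4 * (y ^+ 4 * x ^+ 4 + y * x ^+ 16 + y ^+ 3 * x ^+ 11).
Proof.
move=> x0 x0' y0 H.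
have h4 : x' ^+ 4 <= 3 / 4 * x ^+ 4.
  rewrite -(@ler_sqr R) ?nnegrE ?exprn_ge0 ?mulr_ge0 ?exprn_ge0 //.
  have : 0 <= x ^+ 8 by exact: exprn_ge0.
  by move: H; lra.
have hx : x' <= x.
  rewrite -(@ler_pXn2r R 8) ?nnegrE //.
  have : 0 <= x' ^+ 8 by exact: exprn_ge0.
  by move: H; lra.
have step n : x' ^+ (4 + n) <= 3 / 4 * x ^+ (4 + n).
  rewrite !exprD mulrA; apply: ler_pM; rewrite ?exprn_ge0 //.
  by apply: lerXn2r; rewrite ?nnegrE.
have := ler_wpM2l (exprn_ge0 4 y0) (step 0); have := ler_wpM2l y0 (step 12).
have := ler_wpM2l (exprn_ge0 3 y0) (step 7); rewrite !addn0 /=; lra.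
Qed.

(** * All primes up to [Q] *)

Section Main.
Context {R : realType}.

Definition special_moment (N : nat) (M : int) (a : int -> R[i]) (q : nat) : R :=
  (q%:R / (totient q)%:R) *
    \sum_(xi \in @G1 R q)
       cabs2 (\sum_(k < N) a (M + 1 + k%:Z) * xi (M + 1 + k%:Z)).

(** Induction by halving Q: the primes above Q/2 contribute 54, the others three quarters of 216,
    that is 162, and 54 + 162 = 216. *)
Lemma special_moment_le (Q N : nat) (M : int) (a : int -> R[i]) (x y : R) :
  0 <= x -> x ^+ 8 = Q%:R -> 1 <= y -> y ^+ 4 = N%:R ->
  \sum_(q < Q.+1 | prime q) special_moment N M a q <=
  216 * (y ^+ 4 * x ^+ 4 + y * x ^+ 16 + y ^+ 3 * x ^+ 11) *
  \sum_(k < N) cabs2 (a (M + 1 + k%:Z)).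
Proof.
move=> x0 xQ y1 yN; have y0 : 0 <= y by exact: le_trans y1.
set Z := \sum_(k < N) _.
have Z0 : 0 <= Z by apply: sumr_ge0 => *; exact: cabs2_ge0.
elim/ltn_ind: Q x x0 xQ => Q IH x x0 xQ.
have b0 : 0 <= y ^+ 4 * x ^+ 4 + y * x ^+ 16 + y ^+ 3 * x ^+ 11.
  by rewrite !addr_ge0 // mulr_ge0 ?exprn_ge0.
case: (posnP Q) => [Q0|Q0].
  rewrite big1 ?mulr_ge0 // => q; have := ltn_ord q; rewrite {2}Q0.
  by case: (nat_of_ord q).
rewrite (bigID (fun q : 'I_Q.+1 => (Q < 2 * q)%N)) /=.
pose x' : R := (Q./2)%:R `^ (8^-1).
have x'0 : 0 <= x' by exact: powR_ge0.
have x'Q : x' ^+ 8 = (Q./2)%:R.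
  by rewrite -powR_mulrn // -powRrM mulVf ?powRr1 // pnatr_eq0.
have half : 2 * x' ^+ 8 <= x ^+ 8.
  by rewrite x'Q xQ -natrM ler_nat mul2n -[leqRHS](odd_double_half Q) leq_addl.
have lower : \sum_(q < Q.+1 | prime q && ~~ (Q < 2 * q)%N) special_moment N M a q <=
    162 * (y ^+ 4 * x ^+ 4 + y * x ^+ 16 + y ^+ 3 * x ^+ 11) * Z.
  have hQ : (Q./2 < Q.+1)%N by have := odd_double_half Q; lia.
  have := IH Q./2 _ x' x'0 x'Q.
  rewrite (big_ord_widen_cond Q.+1 (fun q => prime q) (special_moment N M a)) //.
  rewrite (eq_bigl (fun q : 'I_Q.+1 => prime q && ~~ (Q < 2 * q)%N)); last first.
    by move=> q; congr (_ && _); have := odd_double_half Q; lia.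
  move=> H; apply: le_trans (H _) _; first by have := odd_double_half Q; lia.
  rewrite ler_wpM2r //; have := root_halving x0 x'0 y0 half; lra.
have upper : \sum_(q < Q.+1 | prime q && (Q < 2 * q)%N) special_moment N M a q <=
    54 * (y ^+ 4 * x ^+ 4 + y * x ^+ 16 + y ^+ 3 * x ^+ 11) * Z.
  have x1 : 1 <= x.
    by rewrite -(@ler_pXn2r R 8) ?nnegrE // expr1n xQ ler1n.
  apply: le_trans (dyadic_sum_le M x1 y1 xQ yN (fun k => a (M + 1 + k%:Z))).
  rewrite /dyadic_sum; apply: ler_sum => q /andP[pq _].
  exact: (G1_sum_le pq (fun k : 'I_N => M + 1 + k%:Z) (fun k => a (M + 1 + k%:Z))).
apply: le_trans (lerD upper lower) _; rewrite -mulrDl ler_wpM2r //.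
move: b0; lra.
Qed.

End Main.

Theorem theorem3 (R : realType) (eps : R) (heps : 0 < eps) :
  exists C : R, 0 < C /\
  forall (Q N : nat) (M : int) (a : int -> R[i]),
    \sum_(q < Q.+1 | prime q)
       ((q%:R / (totient q)%:R) *
        \sum_(xi \in @G1 R q)
           cabs2 (\sum_(k < N) a (M + 1 + k%:Z) * xi (M + 1 + k%:Z)))
    <= C * ((Q%:R : R) `^ eps) *
         ((N%:R : R) * (Q%:R : R) `^ (2^-1)
          + (N%:R : R) `^ (4^-1) * (Q%:R : R) ^+ 2
          + (N%:R : R) `^ (3 / 4) * (Q%:R : R) `^ (11 / 8)) *
       \sum_(k < N) cabs2 (a (M + 1 + k%:Z)).
Proof.
exists 216; split => // Q N M a.
set Z := \sum_(k < N) cabs2 _.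
have Z0 : 0 <= Z by apply: sumr_ge0 => *; exact: cabs2_ge0.
set b := N%:R * _ + _ + _.
have b0 : 0 <= b by rewrite /b !addr_ge0 // mulr_ge0 ?powR_ge0 ?exprn_ge0.
have rhs0 : 0 <= 216 * (Q%:R : R) `^ eps * b * Z.
  by rewrite mulr_ge0 // mulr_ge0 // mulr_ge0 // powR_ge0.
(* The case N = 0 is separated because y >= 1 needs N >= 1, and the case Q = 0 because Q^eps >= 1
   needs Q >= 1. *)
have [N0|N0] := posnP N.
  apply: le_trans rhs0; apply: sumr_le0 => q pq.
  apply: le_trans (G1_sum_le pq (fun k : 'I_N => M + 1 + k%:Z) (fun k => a (M + 1 + k%:Z))) _.
  rewrite big1 ?mulr0 // => c _; rewrite big1 ?cabs20 // => k.
  by have := ltn_ord k; rewrite {2}N0.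
have [Q0|Q0] := posnP Q.
  rewrite big1 // => q; have := ltn_ord q; rewrite {2}Q0.
  by case: (nat_of_ord q).
pose x : R := Q%:R `^ (8^-1); pose y : R := N%:R `^ (4^-1).
have x0 : 0 <= x by exact: powR_ge0.
have y0 : 0 <= y by exact: powR_ge0.
have xE (c : R) (n : nat) : 8^-1 * n%:R = c -> Q%:R `^ c = x ^+ n.
  by move=> <-; rewrite powRrM powR_mulrn.
have yE (c : R) (n : nat) : 4^-1 * n%:R = c -> N%:R `^ c = y ^+ n.
  by move=> <-; rewrite powRrM powR_mulrn.
have xQ : x ^+ 8 = Q%:R.
  by rewrite -(xE 1) ?powRr1 // mulVf // pnatr_eq0.
have yN : y ^+ 4 = N%:R.
  by rewrite -(yE 1) ?powRr1 // mulVf // pnatr_eq0.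
have y1 : 1 <= y by rewrite -(@ler_pXn2r R 4) ?nnegrE // expr1n yN ler1n.
have bE : b = y ^+ 4 * x ^+ 4 + y * x ^+ 16 + y ^+ 3 * x ^+ 11.
  rewrite /b -/y yN -xQ -exprM; congr (_ * _ + _ + _).
  - by rewrite xQ; apply: xE; field.
  - by rewrite xQ; congr (_ * _); [apply: yE | apply: xE]; field.
apply: le_trans (special_moment_le M a x0 xQ y1 yN) _.
(* The factor Q^eps, at least 1, is inserted here. *)
rewrite -bE -/Z ler_wpM2r // ler_wpM2r // ler_peMr //.
have Q1 : 1 <= Q%:R :> R by rewrite ler1n.
by rewrite -[leLHS](powRr0 (Q%:R : R)) ler_powR // ltW.
Qed.
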